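(* Let $F_{\alpha,\beta}=\{f^n_{\alpha(n),\beta(n)}\}_{n\in\mathbb{N}}$ be a Fučík system with $\alpha(n)=\beta(n)=n^2$ for every odd $n$. Let $\varepsilon,c>0$ be fixed. If the mappings $\alpha$ and $\beta$ satisfy $$ \max\left(\sqrt{\alpha(n)},\sqrt{\beta(n)}\right)\le n+\sqrt{c}\,n^{(1-\varepsilon)/2} $$ for every even $n$, then $F_{\alpha,\beta}$ is a Riesz basis in $L^2(0,\pi)$.
   Context: Consider the boundary value problem $-u''(x)=\alpha u^+(x)-\beta u^-(x)$ in $(0,\pi)$, $u(0)=u(\pi)=0$, where $u^+=\max(u,0)$, $u^-=\max(-u,0)$, and $\alpha,\beta$ are real parameters. For $\alpha,\beta>0$ define the curves: for even $n\ge 2$, $$\Gamma_n=\Big\{(\alpha,\beta):\ \tfrac{n}{2}\tfrac{\pi}{\sqrt{\alpha}}+\tfrac{n}{2}\tfrac{\pi}{\sqrt{\beta}}=\pi\Big\},$$ and for odd $n\ge 3$, $$\Gamma_n=\Big\{(\alpha,\beta):\ \tfrac{n+1}{2}\tfrac{\pi}{\sqrt{\alpha}}+\tfrac{n-1}{2}\tfrac{\pi}{\sqrt{\beta}}=\pi\Big\}.$$ Normalized Fučík eigenfunction: for $n\ge2$ and $(\alpha,\beta)\in\Gamma_n$, $f^n_{\alpha,\beta}$ is the $C^2$-solution of the boundary value problem $-u''=\alpha u^+-\beta u^-$ in $(0,\pi)$, $u(0)=u(\pi)=0$, with $(f^n_{\alpha,\beta})'(0)>0$ and $\sup_{x\in[0,\pi]}|f^n_{\alpha,\beta}(x)|=1$.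 Explicitly, with $l_1=\pi/\sqrt{\alpha}$, $l_2=\pi/\sqrt{\beta}$, $l=l_1+l_2$, $k\in\{0,1,2,\dots\}$: if $\alpha\ge n^2\ge\beta$, then $f^n_{\alpha,\beta}(x)=\frac{\sqrt{\beta}}{\sqrt{\alpha}}\sin(\sqrt{\alpha}(x-kl))$ for $kl\le x<kl+l_1$ and $f^n_{\alpha,\beta}(x)=-\sin(\sqrt{\beta}(x-kl-l_1))$ for $kl+l_1\le x<(k+1)l$; if $\beta>n^2>\alpha$, then $f^n_{\alpha,\beta}(x)=\sin(\sqrt{\alpha}(x-kl))$ for $kl\le x<kl+l_1$ and $f^n_{\alpha,\beta}(x)=-\frac{\sqrt{\alpha}}{\sqrt{\beta}}\sin(\sqrt{\beta}(x-kl-l_1))$ for $kl+l_1\le x<(k+1)l$. For $n=1$, $f^1_{\alpha,\beta}(x)=\sin x$. (For $\alpha=\beta=n^2$ one has $f^n_{\alpha,\beta}(x)=\sin(nx)$.) Fučík system: a sequence $F_{\alpha,\beta}=\{f^n_{\alpha(n),\beta(n)}\}_{n\in\mathbb{N}}$ of normalized Fučík eigenfunctions, where $\alpha,\beta:\mathbb{N}\to\mathbb{R}$ satisfy $\alpha(1)=\beta(1)=1$ and $(\alpha(n),\beta(n))\in\Gamma_n$ for every $n\ge2$. Riesz basis: a system $\{\psi_n\}_{n\in\mathbb{N}}$ in $L^2(0,\pi)$ that is complete (its linear span is dense in $L^2(0,\pi)$) and for which there are constants $c',C'>0$ with $c'\sum_{n=1}^N|a_n|^2\le\|\sum_{n=1}^N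 a_n\psi_n\|^2\le C'\sum_{n=1}^N|a_n|^2$ for all $N\in\mathbb{N}$ and all scalars $a_1,\dots,a_N$, where $\|\cdot\|$ is the standard norm of $L^2(0,\pi)$. *)

(* Defs.v *)
From mathcomp Require Import all_boot all_order all_algebra.
From mathcomp Require Import all_classical all_reals all_analysis.
Set Implicit Arguments.
Unset Strict Implicit.
Unset Printing Implicit Defensive.
Import Order.TTheory GRing.Theory Num.Theory.
Import numFieldNormedType.Exports.
Local Open Scope classical_set_scope.
Local Open Scope ring_scope.

(* Meant for n >= 2; each curve lies in the open quadrant alpha, beta > 0. *)
Definition fucik_curve (R : realType) (n : nat) : set (R * R) :=
  [set ab | let l1 := pi / Num.sqrt ab.1 in
            let l2 := pi / Num.sqrt ab.2 in
    [/\ 0 < ab.1, 0 < ab.2 &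
        (if odd n then n.+1%:R / 2 * l1 + n.-1%:R / 2 * l2
         else n%:R / 2 * l1 + n%:R / 2 * l2) = pi]].

(* u is of class C^2 up to the boundary of [a, b], with derivatives u1 and u2.
   At the end points, u1 and u2 are forced by continuity to be the one-sided
   derivatives; nothing is required of u outside [a, b]. *)
Definition C2_on (R : realType) (a b : R) (u u1 u2 : R -> R) : Prop :=
  [/\ {within `[a, b], continuous u},
      {within `[a, b], continuous u1},
      {within `[a, b], continuous u2} &
      forall x, x \in `]a, b[ ->
        is_derive x (1 : R) u (u1 x) /\ is_derive x (1 : R) u1 (u2 x)].

Definition fucik_solution (R : realType) (alpha beta : R)
    (u u1 u2 : R -> R) : Prop :=
  [/\ C2_on 0 pi u u1 u2,
      forall x, x \in `]0, pi[ -> - u2 x = alpha * u^\+ x - beta * u^\- x &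
      u 0 = 0 /\ u pi = 0].

(* Only the values of f on [0, pi] matter. *)
Definition normalized_fucik_eigenfunction (R : realType) (n : nat)
    (alpha beta : R) (f : R -> R) : Prop :=
  if n == 1%N then forall x, x \in `[0, pi] -> f x = sin x
  else exists f1 f2 : R -> R,
    [/\ fucik_solution alpha beta f f1 f2,
        0 < f1 0 &
        sup [set `|f x| | x in `[0, pi]] = 1].

(* The index set is {1, 2, ...}: alpha 0, beta 0 and F 0 are never used. *)
Definition fucik_system (R : realType) (alpha beta : nat -> R)
    (F : nat -> R -> R) : Prop :=
  [/\ alpha 1%N = 1 /\ beta 1%N = 1,
      forall n, (2 <= n)%N -> fucik_curve n (alpha n, beta n) &
      forall n, (1 <= n)%N ->
        normalized_fucik_eigenfunction n (alpha n) (beta n) (F n)].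

(* L^2(0, pi) consists of the functions whose extension by zero outside
   ]0, pi[ lies in L^2(R). *)
Definition extend0 (R : realType) (f : R -> R) : R -> R := f \_ `]0, pi[.

Definition inL2 (R : realType) (f : R -> R) : Prop :=
  extend0 f \in Lfun (@lebesgue_measure R) 2%:E.

Definition L2norm (R : realType) (f : R -> R) : R :=
  fine ('N[@lebesgue_measure R]_2%:E[EFin \o extend0 f])%E.

Definition lincomb (R : realType) (psi : nat -> R -> R) (N : nat)
    (a : nat -> R) (x : R) : R :=
  \sum_(1 <= n < N.+1) a n * psi n x.

Definition complete_system (R : realType) (psi : nat -> R -> R) : Prop :=
  forall g : R -> R, inL2 g -> forall e : R, 0 < e ->
    exists (N : nat) (a : nat -> R), L2norm (g \- lincomb psi N a) < e.

Definition riesz_basis (R : realType) (psi : nat -> R -> R) : Prop :=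
  [/\ forall n, (1 <= n)%N -> inL2 (psi n),
      complete_system psi &
      exists c1 c2 : R, [/\ 0 < c1, 0 < c2 &
        forall (N : nat) (a : nat -> R),
          c1 * (\sum_(1 <= n < N.+1) `|a n| ^+ 2)
            <= L2norm (lincomb psi N a) ^+ 2
            <= c2 * (\sum_(1 <= n < N.+1) `|a n| ^+ 2)]].

(* Main.v *)
(** Write [V = L^2(0, pi)] and [e_n = sin (n x)]. Up to a factor the [e_n] are
    orthonormal, [F_n = e_n] for odd [n], and for even [n] the uniqueness of
    solutions of the initial value problem shows that [F_n] consists of [n / 2]
    copies of one period of length [2 pi / n]. Two facts make everything work.

    - Smallness: with [d_n = max (sqrt alpha_n) (sqrt beta_n) - n] one has
      [|F_n - e_n| <= (2 + pi) d_n / n] pointwise, which is square summable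
      because [d_n / n = O(n^(- (1 + eps) / 2))].
    - Triangularity: by periodicity, for even [m] and [n], [F_n] is orthogonal
      to [e_m] unless [n] divides [m], whereas [<F_n, e_n> <> 0].

    Modulo the odd modes, the infinite matrix of [(F_n)] in the basis [(e_m)] is
    thus triangular with nonzero diagonal and is a Hilbert-Schmidt perturbation
    of the identity. The modes beyond some [M] are treated by a Neumann series
    (the tail of the perturbation has small Hilbert-Schmidt norm), the finitely
    many remaining ones by forward substitution for the lower bound and by
    backward substitution for completeness.

    The sines themselves are complete because [sin x * p (cos x)] is a sine
    polynomial: choosing [p] among the polynomials [(1 - q^k)^(2^k)], which
    tend to the indicator of [q < 1/2], gives [sin x * 1_(x > c)], and a
    monotone class argument then gives every element of [V], written as [sin x * h x]. *)
Require Import Defs.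
From mathcomp Require Import all_boot all_order all_algebra.
From mathcomp Require Import all_classical all_reals all_analysis.
From mathcomp Require Import measurable_realfun ring lra.
Set Implicit Arguments.
Unset Strict Implicit.
Unset Printing Implicit Defensive.
Import Order.TTheory GRing.Theory Num.Theory.
Import numFieldNormedType.Exports.
Local Open Scope classical_set_scope.
Local Open Scope ring_scope.

(** * Triangular perturbations of an orthonormal system *)

(** The bounded partial sums have a supremum; an [M] whose partial sum comes within [d] of it bounds
    all finite tails at once. *)
Lemma small_tail (R : realType) (rho : nat -> R) (P : pred nat) (B d : R) :
  (forall n, 0 <= rho n) ->
  (forall N : nat, \sum_(1 <= n < N.+1 | P n) rho n <= B) -> 0 < d ->
  exists M : nat, forall N : nat, \sum_(M.+1 <= n < N.+1 | P n) rho n <= d.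
Proof.
move=> rho0 rhoB d0.
pose S := range (fun N : nat => \sum_(1 <= n < N.+1 | P n) rho n).
have supS : has_sup S.
  split; first by exists (\sum_(1 <= n < 1 | P n) rho n), 0%N.
  by exists B => _ [N _ <-]; exact: rhoB.
have [_ [M _ <-] SM] := sup_adherent d0 supS.
exists M => N; have [NM|MN] := leqP N M.
  by rewrite big_geq ?ltnS// ltW.
have : \sum_(1 <= n < N.+1 | P n) rho n <= sup S by apply: sup_ubound; [exact: supS.2|exists N].
rewrite (@big_cat_nat _ _ _ M.+1)//= ?ltnS 1?ltnW//; lra.
Qed.

(** * Semi-inner products and closed spans *)

Section SemiInner.
Context (R : realType) (V : lmodType R) (ip : V -> V -> R).
Hypothesis ipC : forall x y, ip x y = ip y x.
Hypothesis ipDl : forall x y z, ip (x + y) z = ip x z + ip y z.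
Hypothesis ipZl : forall a x y, ip (a *: x) y = a * ip x y.
Hypothesis ip_ge0 : forall x, 0 <= ip x x.

Let sq x := ip x x.

Lemma ip0l y : ip 0 y = 0.
Proof. by rewrite -(scale0r 0) ipZl mul0r. Qed.

Lemma ipNl x y : ip (- x) y = - ip x y.
Proof. by rewrite -scaleN1r ipZl mulN1r. Qed.

Lemma ipBl x y z : ip (x - y) z = ip x z - ip y z.
Proof. by rewrite ipDl ipNl. Qed.

Lemma ipNr x y : ip y (- x) = - ip y x.
Proof. by rewrite ipC ipNl (ipC y). Qed.

Lemma ipDr x y z : ip z (x + y) = ip z x + ip z y.
Proof. by rewrite ipC ipDl !(ipC z). Qed.

Lemma ipBr x y z : ip z (x - y) = ip z x - ip z y.
Proof. by rewrite ipC ipBl !(ipC z). Qed.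

Lemma ipZr a x y : ip y (a *: x) = a * ip y x.
Proof. by rewrite ipC ipZl (ipC y). Qed.

Lemma ip_suml I (r : seq I) (P : pred I) (f : I -> V) y :
  ip (\sum_(i <- r | P i) f i) y = \sum_(i <- r | P i) ip (f i) y.
Proof.
by elim/big_ind2 : _ => [|u u' v v' <- <-|//]; [exact: ip0l|rewrite ipDl].
Qed.

Lemma ip_sumr I (r : seq I) (P : pred I) (f : I -> V) y :
  ip y (\sum_(i <- r | P i) f i) = \sum_(i <- r | P i) ip y (f i).
Proof. by rewrite ipC ip_suml; apply: eq_bigr => i _; rewrite ipC. Qed.

Lemma ip_sqZ a x : ip (a *: x) (a *: x) = a ^+ 2 * sq x.
Proof. by rewrite ipZl ipZr mulrA -expr2. Qed.

Lemma ip_sqD_le x y : sq (x + y) <= 2 * sq x + 2 * sq y.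
Proof.
have := ip_ge0 (x - y).
rewrite /sq !(ipDl, ipDr, ipNl, ipNr) (ipC y x). lra.
Qed.

Lemma ip_sqN x : sq (- x) = sq x.
Proof. by rewrite -scaleN1r /sq ip_sqZ sqrrN expr1n mul1r. Qed.

Lemma ip_sqD_le3 x y z : sq (x + y + z) <= 3 * sq x + 3 * sq y + 3 * sq z.
Proof.
have := ip_ge0 (x - y); have := ip_ge0 (x - z); have := ip_ge0 (y - z).
rewrite /sq !(ipDl, ipDr, ipNl, ipNr) (ipC y x) (ipC z x) (ipC z y); lra.
Qed.

(* Expanding [sum_(i, j) |a_i v_j - a_j v_i|^2 >= 0] avoids square roots. *)
Lemma ip_sq_sum_le (I : Type) (r : seq I) (P : pred I) (a : I -> R) (v : I -> V) :
  sq (\sum_(i <- r | P i) a i *: v i) <=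
  (\sum_(i <- r | P i) a i ^+ 2) * (\sum_(i <- r | P i) sq (v i)).
Proof.
have : 0 <= \sum_(i <- r | P i) \sum_(j <- r | P j) sq (a i *: v j - a j *: v i).
  by apply: sumr_ge0 => i _; apply: sumr_ge0 => j _; exact: ip_ge0.
under eq_bigr do under eq_bigr => j _ do
  rewrite {1}/sq ipBl !ipBr !ip_sqZ ipZl ipZr ipZl ipZr.
set S := (X in sq X).
have E1 : \sum_(i <- r | P i) \sum_(j <- r | P j) a i ^+ 2 * sq (v j) =
    (\sum_(i <- r | P i) a i ^+ 2) * (\sum_(i <- r | P i) sq (v i)).
  by rewrite big_distrl/=; apply: eq_bigr => i _; rewrite big_distrr.
have E2 : \sum_(i <- r | P i) \sum_(j <- r | P j) a j ^+ 2 * sq (v i) =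
    (\sum_(i <- r | P i) a i ^+ 2) * (\sum_(i <- r | P i) sq (v i)).
  by rewrite exchange_big.
have E3 : \sum_(i <- r | P i) \sum_(j <- r | P j) a i * (a j * ip (v j) (v i)) = sq S.
  rewrite /sq /S ip_suml exchange_big/=; apply: eq_bigr => i _.
  rewrite ip_sumr; apply: eq_bigr => j _; rewrite ipZl ipZr; ring.
have E4 : \sum_(i <- r | P i) \sum_(j <- r | P j) a j * (a i * ip (v i) (v j)) = sq S.
  by rewrite exchange_big.
under eq_bigr do rewrite !sumrB.
rewrite !sumrB E1 E2 E3 E4; lra.
Qed.

Definition in_span (u : nat -> V) (s : V) : Prop :=
  exists (N : nat) (a : nat -> R), s = \sum_(1 <= n < N.+1) a n *: u n.

(** Closure for the seminorm attached to [ip], measured by squares so that no square root enters. *)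
Definition in_closed_span (u : nat -> V) (x : V) : Prop :=
  forall d : R, 0 < d -> exists2 s, in_span u s & sq (x - s) < d.

(** Padding with zero coefficients brings combinations of different lengths to a common range. *)
Lemma lincomb_widen (u : nat -> V) (N M : nat) (a : nat -> R) : (N <= M)%N ->
  \sum_(1 <= n < N.+1) a n *: u n =
  \sum_(1 <= n < M.+1) (if (n <= N)%N then a n else 0) *: u n.
Proof.
move=> NM; rewrite [RHS](@big_cat_nat _ _ _ N.+1)//= [X in _ + X]big1_seq ?addr0.
  by rewrite !big_nat; apply: eq_bigr => i /andP[_]; rewrite ltnS => ->.
by move=> i /andP[_]; rewrite mem_index_iota => /andP[Ni _]; rewrite leqNgt Ni scale0r.
Qed.

Lemma in_spanD u s t : in_span u s -> in_span u t -> in_span u (s + t).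
Proof.
move=> [N [a ->]] [M [b ->]].
rewrite (lincomb_widen _ _ (leq_maxl N M)) (lincomb_widen _ _ (leq_maxr N M)).
rewrite -big_split/=; do 2 eexists; apply: eq_bigr => i _.
by rewrite -scalerDl; reflexivity.
Qed.

Lemma in_spanZ u c s : in_span u s -> in_span u (c *: s).
Proof.
move=> [N [a ->]]; exists N, (fun n => c * a n).
by rewrite scaler_sumr; apply: eq_bigr => i _; rewrite scalerA.
Qed.

Lemma in_span0 u : in_span u 0.
Proof. by exists 0%N, (fun=> 0); rewrite big_geq. Qed.

Lemma in_span_mem u n : (0 < n)%N -> in_span u (u n).
Proof.
move=> n0; exists n, (fun m => (m == n)%:R).
rewrite big_nat_recr//= eqxx scale1r big1_seq ?add0r// => i /andP[_].
by rewrite mem_index_iota => /andP[_ /ltn_eqF->]; rewrite scale0r.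
Qed.

Lemma in_span_sum u (I : eqType) (r : seq I) (P : pred I) (f : I -> V) :
  (forall i, i \in r -> P i -> in_span u (f i)) -> in_span u (\sum_(i <- r | P i) f i).
Proof.
move=> h; rewrite big_seq_cond; apply: big_ind => [|x y|i /andP[]].
- exact: in_span0.
- exact: in_spanD.
- exact: h.
Qed.

Lemma in_closed_span_span u x : in_span u x -> in_closed_span u x.
Proof. by move=> ux d d0; exists x => //; rewrite subrr /sq ip0l. Qed.

Lemma in_closed_spanD u x y :
  in_closed_span u x -> in_closed_span u y -> in_closed_span u (x + y).
Proof.
move=> ux uy d d0; have d4 : 0 < d / 4 by rewrite divr_gt0.
have [s us sx] := ux _ d4; have [t ut ty] := uy _ d4.
exists (s + t); first exact: in_spanD.
rewrite opprD addrACA; apply: le_lt_trans (ip_sqD_le _ _) _; lra.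
Qed.

Lemma in_closed_spanZ u c x : in_closed_span u x -> in_closed_span u (c *: x).
Proof.
(* Dividing by [c ^+ 2 + 1] instead of [c ^+ 2] also covers [c = 0]. *)
move=> ux d d0; have c1 : 0 < c ^+ 2 + 1 by rewrite ltr_wpDl ?sqr_ge0.
have [|s us sx] := ux (d / (c ^+ 2 + 1)); first by rewrite divr_gt0.
exists (c *: s); first exact: in_spanZ.
rewrite -scalerBr /sq ip_sqZ; rewrite ltr_pdivlMr// in sx.
have := ip_ge0 (x - s); rewrite -/(sq _) in sx *; nra.
Qed.

Lemma in_closed_span_sum u (I : eqType) (r : seq I) (P : pred I) (f : I -> V) :
  (forall i, i \in r -> P i -> in_closed_span u (f i)) ->
  in_closed_span u (\sum_(i <- r | P i) f i).
Proof.
move=> h; rewrite big_seq_cond; apply: big_ind => [|x y|i /andP[]].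
- exact/in_closed_span_span/in_span0.
- exact: in_closed_spanD.
- exact: h.
Qed.

Lemma in_closed_span_closed u x :
  (forall d, 0 < d -> exists2 y, in_closed_span u y & sq (x - y) < d) ->
  in_closed_span u x.
Proof.
move=> ux d d0; have d4 : 0 < d / 4 by rewrite divr_gt0.
have [y uy xy] := ux _ d4; have [s us ys] := uy _ d4.
exists s => //; rewrite -(subrK y x) -addrA.
apply: le_lt_trans (ip_sqD_le _ _) _; lra.
Qed.

Lemma in_closed_span_trans u v x :
  (forall n, (0 < n)%N -> in_closed_span v (u n)) ->
  in_closed_span u x -> in_closed_span v x.
Proof.
move=> uv ux; apply: in_closed_span_closed => d d0.
have [s [N [a ->]] sx] := ux _ d0.
eexists; last exact: sx.
apply: in_closed_span_sum => i; rewrite mem_index_iota => /andP[i0 _] _.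
by apply: in_closed_spanZ; exact: uv.
Qed.

(** * Orthonormal systems: Bessel's inequality and best approximation *)

Section Orthonormal.
Variable e : nat -> V.
Hypothesis e_orth : forall m n, (0 < m)%N -> (0 < n)%N -> ip (e m) (e n) = (m == n)%:R.

Lemma ip_lincomb_orth (r : seq nat) (P : pred nat) (a : nat -> R) m :
  uniq r -> (forall i, i \in r -> P i -> (0 < i)%N) -> (0 < m)%N ->
  ip (\sum_(i <- r | P i) a i *: e i) (e m) = if (m \in r) && P m then a m else 0.
Proof.
move=> ur r0 m0; rewrite ip_suml.
under eq_bigr do rewrite ipZl.
have [/andP[mr Pm]|] := ifPn.
  rewrite -big_filter (bigD1_seq m) ?mem_filter ?Pm ?filter_uniq//=.
  rewrite e_orth// eqxx mulr1 big_seq_cond big1 ?addr0// => i.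
  by rewrite mem_filter => /andP[/andP[Pi ir] im]; rewrite e_orth ?(r0 i)// (negPf im) mulr0.
move=> nmr; rewrite big_seq_cond big1// => i /andP[ir Pi].
rewrite e_orth ?(r0 i)//; case: (eqVneq i m) => [im|_]; last by rewrite mulr0.
by rewrite -im ir Pi in nmr.
Qed.

Lemma sq_lincomb_orth (r : seq nat) (P : pred nat) (a : nat -> R) :
  uniq r -> (forall i, i \in r -> P i -> (0 < i)%N) ->
  sq (\sum_(i <- r | P i) a i *: e i) = \sum_(i <- r | P i) a i ^+ 2.
Proof.
move=> ur r0; rewrite /sq ip_sumr big_seq_cond [RHS]big_seq_cond.
apply: eq_bigr => i /andP[ir Pi].
by rewrite ipZr ip_lincomb_orth ?r0// ir Pi.
Qed.

(** Completing the square in each coefficient. The Fourier coefficients minimize the right-hand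
    side, which yields both Bessel's inequality and best approximation. *)
Lemma sq_sub_fourier (r : seq nat) (P : pred nat) (a : nat -> R) x :
  uniq r -> (forall i, i \in r -> P i -> (0 < i)%N) ->
  sq (x - \sum_(i <- r | P i) a i *: e i) =
  sq x - \sum_(i <- r | P i) ip x (e i) ^+ 2
  + \sum_(i <- r | P i) (a i - ip x (e i)) ^+ 2.
Proof.
move=> ur r0; rewrite {1}/sq ipBl !ipBr -/(sq x) -/(sq _) (sq_lincomb_orth _ ur r0).
rewrite (ipC _ x) ip_sumr.
under eq_bigr do rewrite ipZr.
have -> : \sum_(i <- r | P i) (a i - ip x (e i)) ^+ 2 =
    \sum_(i <- r | P i) a i ^+ 2 - 2 * \sum_(i <- r | P i) a i * ip x (e i)
    + \sum_(i <- r | P i) ip x (e i) ^+ 2.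
  by rewrite mulr_sumr -sumrB -big_split; apply: eq_bigr => i _ /=; ring.
ring.
Qed.

Lemma bessel (r : seq nat) (P : pred nat) x :
  uniq r -> (forall i, i \in r -> P i -> (0 < i)%N) ->
  \sum_(i <- r | P i) ip x (e i) ^+ 2 <= sq x.
Proof.
move=> ur r0; rewrite -subr_ge0.
have := sq_sub_fourier (fun i => ip x (e i)) x ur r0.
rewrite [X in _ = _ + X]big1 => [|i _]; last by rewrite subrr expr0n.
by rewrite addr0 => <-; exact: ip_ge0.
Qed.

(** By best approximation, the Fourier sum is at least as close to [x] as any combination of the
    same length; [N0] lets the caller force the sum to be long. *)
Lemma fourier_approx x (N0 : nat) (d : R) : in_closed_span e x -> 0 < d ->
  exists2 N, (N0 <= N)%N & sq (x - \sum_(1 <= n < N.+1) ip x (e n) *: e n) < d.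
Proof.
move=> ex d0; have [s [N [a ->]] sd] := ex _ d0.
exists (maxn N0 N); first exact: leq_maxl.
have r0 (i : nat) : i \in index_iota 1 (maxn N0 N).+1 -> xpredT i -> (0 < i)%N.
  by rewrite mem_index_iota => /andP[].
apply: le_lt_trans sd; rewrite (lincomb_widen _ _ (leq_maxr N0 N)).
rewrite !sq_sub_fourier ?iota_uniq// lerD2l.
rewrite big1 => [|i _]; last by rewrite subrr expr0n.
by rewrite sumr_ge0// => i _; exact: sqr_ge0.
Qed.

(** * Perturbing the even members of a complete orthonormal system *)

Section TriangularPerturbation.
Hypothesis e_complete : forall x, in_closed_span e x.
Variable F : nat -> V.
Hypothesis F_odd : forall n, odd n -> F n = e n.
Hypothesis F_tri : forall m n, (0 < m)%N -> (0 < n)%N -> ~~ odd m -> ~~ odd n ->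
  ~~ (n %| m)%N -> ip (F n) (e m) = 0.
Hypothesis F_diag : forall n, (0 < n)%N -> ~~ odd n -> ip (F n) (e n) != 0.
Variable B : R.
Hypothesis F_near : forall N,
  \sum_(1 <= n < N.+1 | ~~ odd n) sq (F n - e n) <= B.

Let tail_pos M N (i : nat) : i \in index_iota M.+1 N -> ~~ odd i -> (0 < i)%N.
Proof. by rewrite mem_index_iota => /andP[/(leq_ltn_trans (leq0n _))]. Qed.

Let pos1 N (P : pred nat) (i : nat) : i \in index_iota 1 N -> P i -> (0 < i)%N.
Proof. by rewrite mem_index_iota => /andP[]. Qed.

(* Each step of the Neumann series divides the squared distance by 3. *)
Lemma tail_in_span_approx M :
  (forall N, \sum_(M.+1 <= n < N.+1 | ~~ odd n) sq (F n - e n) <= 6^-1) ->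
  forall k (N : nat) (c : nat -> R) (d : R), 0 < d ->
  let v := \sum_(M.+1 <= n < N.+1 | ~~ odd n) c n *: e n in
  exists2 s, in_span F s & sq (v - s) <= 3^-1 ^+ k * sq v + d.
Proof.
move=> tailM; elim => [N c d d0 v|k IH N c d d0 v].
  by exists 0; [exact: in_span0|rewrite subr0 expr0 mul1r lerDl ltW].
(* First Neumann step: replacing each [e n] by [F n] leaves a residual [r] with
   [sq r <= sq v / 6]. *)
pose w := \sum_(M.+1 <= n < N.+1 | ~~ odd n) c n *: F n.
pose r := v - w.
have sqv : sq v = \sum_(M.+1 <= n < N.+1 | ~~ odd n) c n ^+ 2.
  by apply: sq_lincomb_orth; [exact: iota_uniq|exact: tail_pos].
have sqr : sq r <= 6^-1 * sq v.
  have -> : r = - \sum_(M.+1 <= n < N.+1 | ~~ odd n) c n *: (F n - e n).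
    by rewrite /r /v /w -sumrB -sumrN; apply: eq_bigr => i _; rewrite scalerBr opprB.
  rewrite ip_sqN; apply: le_trans (ip_sq_sum_le _ _ _ _) _.
  rewrite sqv mulrC ler_wpM2r// sumr_ge0// => i _; exact: sqr_ge0.
(* An index beyond [M] cannot divide [m <= M]. Hence [r] consists of odd modes, which belong to [F],
   and of even modes beyond [M], to which the induction hypothesis applies. *)
have r_low m : (0 < m <= M)%N -> ~~ odd m -> ip r (e m) = 0.
  move=> /andP[m0 mM] om; rewrite ipBl.
  rewrite (ip_lincomb_orth _ (iota_uniq _ _) (@tail_pos _ _))//.
  rewrite mem_index_iota ltnNge mM/= ip_suml big_seq_cond big1 ?subrr// => i.
  rewrite mem_index_iota => /andP[/andP[Mi iN] oi].
  rewrite ipZl F_tri ?mulr0//; first exact: leq_ltn_trans Mi.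
  by apply/negP => /(dvdn_leq m0); rewrite leqNgt (leq_ltn_trans mM Mi).
(* The doubling in [ip_sqD_le] turns the factor 1/6 into 1/3, and the two errors add up to
   [2 (d / 16) + 2 (d / 4) < d]. *)
have d16 : 0 < d / 16 by rewrite divr_gt0.
have [N' MN' rN'] := fourier_approx M (e_complete r) d16.
pose v' := \sum_(M.+1 <= n < N'.+1 | ~~ odd n) ip r (e n) *: e n.
pose o := \sum_(1 <= n < N'.+1 | odd n) ip r (e n) *: e n.
have rE : \sum_(1 <= n < N'.+1) ip r (e n) *: e n = o + v'.
  rewrite (bigID odd)/=; congr (_ + _).
  rewrite (@big_cat_nat _ _ _ M.+1)//= [X in X + _]big1_seq ?add0r// => i.
  rewrite mem_index_iota => /andP[oi]; rewrite ltnS => /r_low -> //.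
  by rewrite scale0r.
have sqv' : sq v' <= 6^-1 * sq v.
  apply: le_trans sqr; rewrite (sq_lincomb_orth _ (iota_uniq _ _) (@tail_pos _ _)).
  by apply: bessel; [exact: iota_uniq|exact: tail_pos].
have d4 : 0 < d / 4 by rewrite divr_gt0.
have [s' Fs' vs'] := IH N' (fun n => ip r (e n)) _ d4.
exists (w + o + s').
  apply: in_spanD Fs'; apply: in_spanD; apply: in_span_sum => i;
    rewrite mem_index_iota => /andP[i0 _] oi; apply: in_spanZ.
    by apply: in_span_mem; exact: leq_ltn_trans i0.
  by rewrite -F_odd//; exact: in_span_mem.
have -> : v - (w + o + s') = (r - (o + v')) + (v' - s').
  by rewrite /r !opprD !addrA addrNK.
rewrite rE in rN'; apply: le_trans (ip_sqD_le _ _) _.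
have : 3^-1 ^+ k * sq v' <= 3^-1 ^+ k * (6^-1 * sq v).
  by rewrite ler_wpM2l// exprn_ge0// invr_ge0.
rewrite exprS; rewrite -/v' in vs'; lra.
Qed.

(** Odd modes belong to [F] and even modes beyond [M] come from the Neumann series. The other even
    modes follow by backward substitution: apart from odd modes, [F n] involves only [e n] and even
    modes of larger index. *)
Lemma orthonormal_in_closed_span n : (0 < n)%N -> in_closed_span F (e n).
Proof.
have sixth0 : (0 : R) < 6^-1 by rewrite invr_gt0.
have rho0 (i : nat) : 0 <= sq (F i - e i) by exact: ip_ge0.
have [M tailM] := small_tail rho0 F_near sixth0.
have tail m : (M < m)%N -> ~~ odd m -> in_closed_span F (e m).
  move=> Mm om d d0; have d2 : 0 < d / 2 by rewrite divr_gt0.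
  have m0 : (0 < m)%N by exact: leq_ltn_trans Mm.
  have [k kd] : exists k : nat, (3^-1 : R) ^+ k < d / 2.
    exists (Num.truncn (d / 2)^-1).+1.
    rewrite exprVn invf_plt ?posrE ?exprn_gt0//.
    apply: lt_le_trans (truncnS_gt _) _.
    by rewrite -natrX ler_nat ltnW// ltn_expl.
  have [s Fs] := tail_in_span_approx tailM k m (fun i => (i == m)%:R) d2.
  rewrite big_mkcond big_nat_recr//= om eqxx scale1r big1_seq ?add0r; last first.
    move=> i /andP[_]; rewrite mem_index_iota => /andP[_ /ltn_eqF->].
    by rewrite scale0r if_same.
  rewrite {2}/sq e_orth// eqxx mulr1 => sd; exists s => //; lra.
(* The measure [M - n] drops when [n <= M] increases, so the induction runs from [M] downwards. *)
have [k] := ubnP (M - n); elim: k n => // k IH n; rewrite ltnS => Mnk n0.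
have [on|on] := boolP (odd n).
  by rewrite -F_odd//; exact/in_closed_span_span/in_span_mem.
have [nM|] := leqP n M; last by move/tail; apply.
pose b := ip (F n) (e n).
rewrite -(scale1r (e n)) -(mulVf (F_diag n0 on)) -scalerA; apply: in_closed_spanZ.
apply: in_closed_span_closed => d d0.
have [N nN FN] := fourier_approx n (e_complete (F n)) d0.
(* The Fourier expansion of [F n], cut at [N], is solved for its term of index [n]. *)
exists (F n - \sum_(1 <= m < N.+1 | m != n) ip (F n) (e m) *: e m).
  apply: in_closed_spanD; first exact/in_closed_span_span/in_span_mem.
  rewrite -scaleN1r; apply: in_closed_spanZ; apply: in_closed_span_sum => m.
  rewrite mem_index_iota => /andP[m0 _] mn.
  have [om|om] := boolP (odd m).
    by apply: in_closed_spanZ; rewrite -F_odd//; exact/in_closed_span_span/in_span_mem.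
  have [mln|nm] := ltnP m n.
    rewrite F_tri ?scale0r//; first exact/in_closed_span_span/in_span0.
    by apply/negP => /(dvdn_leq m0); rewrite leqNgt mln.
  have {nm}nm : (n < m)%N by rewrite ltn_neqAle eq_sym mn.
  apply: in_closed_spanZ; have [Mm|mM] := ltnP M m; first exact: tail.
  by apply: IH => //; apply: leq_trans Mnk; rewrite ltn_sub2l// (leq_trans nm).
rewrite -ip_sqN opprB; congr (_ < _): FN.
congr (sq _); rewrite (bigD1_seq n) ?iota_uniq//=; last by rewrite mem_index_iota n0.
by rewrite opprD addrA addrAC.
Qed.

Lemma perturbed_complete x : in_closed_span F x.
Proof. exact: in_closed_span_trans orthonormal_in_closed_span (e_complete x). Qed.

(** With [F n = e n + (F n - e n)], the first part is orthonormal, and Cauchy-Schwarz bounds the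
    second by the squared Hilbert-Schmidt norm of the perturbation, which is at most [B]. *)
Lemma perturbed_upper (N : nat) (a : nat -> R) :
  sq (\sum_(1 <= n < N.+1) a n *: F n) <=
  (2 + 2 * B) * \sum_(1 <= n < N.+1) a n ^+ 2.
Proof.
have -> : \sum_(1 <= n < N.+1) a n *: F n =
    \sum_(1 <= n < N.+1) a n *: e n +
    \sum_(1 <= n < N.+1 | ~~ odd n) a n *: (F n - e n).
  rewrite [X in _ + X]big_mkcond/= -big_split; apply: eq_bigr => i _ /=.
  case: ifPn => [_|/negPn oi]; first by rewrite -scalerDr addrC subrK.
  by rewrite addr0 F_odd.
apply: le_trans (ip_sqD_le _ _) _; rewrite [leRHS]mulrDl lerD//.
  by rewrite (sq_lincomb_orth _ (iota_uniq _ _) (@pos1 _ _)).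
rewrite -mulrA ler_wpM2l//; apply: le_trans (ip_sq_sum_le _ _ _ _) _.
rewrite mulrC ler_pM ?sumr_ge0// => [i _|i _|].
- exact: ip_ge0.
- exact: sqr_ge0.
- rewrite [leRHS](bigID odd)/= lerDr sumr_ge0// => i _; exact: sqr_ge0.
Qed.

(** Forward substitution: for even [m.+1], the product with [e m.+1] sees only the [F n] with [n]
    even and [n <= m.+1], so [a m.+1] is controlled by the whole combination and the earlier even
    coefficients. *)
Lemma perturbed_head_lower m : exists2 C : R, 0 <= C & forall N (a : nat -> R), (m <= N)%N ->
  \sum_(1 <= n < m.+1 | ~~ odd n) a n ^+ 2 <=
  C * sq (\sum_(1 <= n < N.+1) a n *: F n).
Proof.
elim: m => [|m [C C0 IH]].
  by exists 0 => // N a _; rewrite big_geq// mul0r.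
have [/= om|/= om] := boolP (odd m.+1).
  exists C => // N a mN; rewrite big_mkcond big_nat_recr//= -big_mkcond/=.
  by rewrite om/= addr0 IH// ltnW.
pose K := \sum_(1 <= n < m.+1 | ~~ odd n) ip (F n) (e m.+1) ^+ 2.
have K0 : 0 <= K by apply: sumr_ge0 => i _; exact: sqr_ge0.
pose b := ip (F m.+1) (e m.+1).
have b0 : 0 < b ^+ 2 by rewrite exprn_even_gt0// F_diag.
(* This comes from [(x - y)^2 <= 2 x^2 + 2 y^2], where [x] is the product of the combination with
   [e m.+1], bounded by Bessel, and [y] is the share of the earlier coefficients, whose square costs
   [C * K]. Division by [b ^+ 2] isolates the new coefficient. *)
exists (C + (2 + 2 * (C * K)) / b ^+ 2).
  by rewrite addr_ge0// divr_ge0 ?(ltW b0)// addr_ge0// mulr_ge0// mulr_ge0.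
move=> N a mN; rewrite big_mkcond big_nat_recr//= -big_mkcond/= om [leRHS]mulrDl lerD//.
  by rewrite IH// ltnW.
set u := \sum_(1 <= n < N.+1) a n *: F n.
rewrite mulrAC ler_pdivlMr// -exprMn.
pose y := \sum_(1 <= n < m.+1 | ~~ odd n) a n * ip (F n) (e m.+1).
have -> : a m.+1 * b = ip u (e m.+1) - y.
  rewrite /u ip_suml (@big_cat_nat _ _ _ m.+2)//= big_nat_recr//= ipZl.
  rewrite [X in _ + _ + X]big1_seq ?addr0; last first.
    move=> i /andP[_]; rewrite mem_index_iota => /andP[mi iN].
    have i0 : (0 < i)%N by exact: leq_ltn_trans mi.
    have [oi|oi] := boolP (odd i).
      by rewrite F_odd// ipZl e_orth// gtn_eqF// mulr0.
    rewrite ipZl F_tri ?mulr0//.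
    by apply/negP => /(dvdn_leq (ltn0Sn m)); rewrite leqNgt mi.
  rewrite (bigID odd)/= big1_seq ?add0r; last first.
    move=> i /andP[oi]; rewrite mem_index_iota => /andP[i0 im].
    by rewrite F_odd// ipZl e_orth// ltn_eqF// mulr0.
  under eq_bigr do rewrite ipZl.
  by rewrite -/y addrAC subrr add0r.
have ley : y ^+ 2 <= C * K * sq u.
  have : y ^+ 2 <= (\sum_(1 <= n < m.+1 | ~~ odd n) a n ^+ 2) * K.
    (* Placing the scalars on the line spanned by the unit vector [e m.+1] reduces the scalar
       Cauchy-Schwarz inequality to the vector one. *)
    have sqe c : sq (c *: e m.+1) = c ^+ 2 by rewrite /sq ip_sqZ /sq e_orth// eqxx mulr1.
    rewrite -sqe /y scaler_suml.
    under eq_bigr do rewrite -scalerA.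
    apply: le_trans (ip_sq_sum_le _ _ _ _) _.
    by under [X in _ * X]eq_bigr do rewrite sqe.
  move=> /le_trans; apply; rewrite mulrAC ler_wpM2r// IH// ltnW//.
have lex : ip u (e m.+1) ^+ 2 <= sq u.
  by have := @bessel [:: m.+1] xpredT u isT; rewrite big_seq1; apply => i; rewrite inE => /eqP->.
have := sqr_ge0 (ip u (e m.+1) + y); nra.
Qed.

(** Removing from [u] the even head [Y] and the tail perturbation [Z] leaves an orthonormal
    combination that carries all other coefficients. The head is controlled by
    [perturbed_head_lower], and [Z] is small enough to be absorbed. *)
Lemma perturbed_lower : exists2 c : R, 0 < c & forall N (a : nat -> R),
  c * \sum_(1 <= n < N.+1) a n ^+ 2 <= sq (\sum_(1 <= n < N.+1) a n *: F n).
Proof.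
have sixth0 : (0 : R) < 6^-1 by rewrite invr_gt0.
have rho0 (i : nat) : 0 <= sq (F i - e i) by exact: ip_ge0.
have [M tailM] := small_tail rho0 F_near sixth0.
have [C C0 head] := perturbed_head_lower M.
pose K := \sum_(1 <= n < M.+1 | ~~ odd n) sq (F n).
have K0 : 0 <= K by apply: sumr_ge0 => i _; exact: ip_ge0.
(* With [L = sq (u - Y - Z)] and [sq Z <= L / 6], the three-term inequality gives
   [L <= (3 + 3 C K) sq u + L / 2], hence [L <= (6 + 6 C K) sq u]; the head coefficients add [C]. *)
have D0 : 0 < 6 + 6 * (C * K) + C.
  by rewrite -addrA ltr_pwDl// addr_ge0// !mulr_ge0.
exists (6 + 6 * (C * K) + C)^-1; first by rewrite invr_gt0.
(* Combinations shorter than [M] are padded with zeros. *)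
suff main N (a : nat -> R) : (M <= N)%N ->
    \sum_(1 <= n < N.+1) a n ^+ 2 <=
    (6 + 6 * (C * K) + C) * sq (\sum_(1 <= n < N.+1) a n *: F n).
  move=> N a; rewrite mulrC ler_pdivrMr// [leRHS]mulrC.
  pose a' n := if (n <= N)%N then a n else 0.
  rewrite (lincomb_widen _ _ (leq_maxl N M)).
  apply: le_trans (main _ _ (leq_maxr N M)).
  rewrite [leRHS](@big_cat_nat _ _ _ N.+1) ?ltnS ?leq_maxl//=.
  rewrite -[leLHS]addr0 lerD//; last by apply: sumr_ge0 => i _; exact: sqr_ge0.
  by rewrite !big_nat ler_sum// => i /andP[_]; rewrite ltnS => ->.
move=> MN; set u := \sum_(1 <= n < N.+1) a n *: F n.
pose Y := \sum_(1 <= n < M.+1 | ~~ odd n) a n *: F n.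
pose Z := \sum_(M.+1 <= n < N.+1 | ~~ odd n) a n *: (F n - e n).
pose H := \sum_(1 <= n < M.+1 | ~~ odd n) a n ^+ 2.
pose T := \sum_(M.+1 <= n < N.+1 | ~~ odd n) a n ^+ 2.
pose P n := odd n || (M < n)%N.
have uE : u - Y - Z = \sum_(1 <= n < N.+1 | P n) a n *: e n.
  have -> : u = \sum_(1 <= n < N.+1 | P n) a n *: F n + Y.
    rewrite /u (bigID P)/=; congr (_ + _).
    rewrite (@big_cat_nat _ _ _ M.+1)//= [X in _ + X]big1_seq ?addr0.
      rewrite /Y big_nat_cond [RHS]big_nat_cond; apply: eq_bigl => i; rewrite ltnS /P negb_or -leqNgt.
      by case: (i <= M)%N; rewrite ?andbF ?andbT.
    by move=> i; rewrite mem_index_iota /P => /andP[/norP[_ /negPf->]].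
  rewrite addrK.
  have -> : Z = \sum_(1 <= n < N.+1 | P n) a n *: (F n - e n).
    rewrite [RHS](@big_cat_nat _ _ _ M.+1)//= [X in _ = X + _]big1_seq ?add0r.
      rewrite /Z big_mkcond [RHS]big_mkcond/= !big_nat.
      apply: eq_bigr => i /andP[Mi _]; rewrite /P Mi orbT.
      by case: ifPn => // /negPn oi; rewrite F_odd// subrr scaler0.
    move=> i; rewrite mem_index_iota /P ltnS => /andP[/orP[oi _|Mi /andP[_]]].
      by rewrite F_odd// subrr scaler0.
    by rewrite leqNgt Mi.
  by rewrite -sumrB; apply: eq_bigr => i _; rewrite scalerBr opprB addrC subrK.
have sqL : sq (u - Y - Z) = \sum_(1 <= n < N.+1 | P n) a n ^+ 2.
  by rewrite uE (sq_lincomb_orth _ (iota_uniq _ _) (@pos1 _ _)).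
have sumE : \sum_(1 <= n < N.+1) a n ^+ 2 = H + sq (u - Y - Z).
  rewrite sqL (bigID P)/= addrC; congr (_ + _).
  rewrite (@big_cat_nat _ _ _ M.+1)//= [X in _ + X]big1_seq ?addr0.
    rewrite /H big_nat_cond [RHS]big_nat_cond; apply: eq_bigl => i; rewrite ltnS /P negb_or -leqNgt.
    by case: (i <= M)%N; rewrite ?andbF ?andbT.
  by move=> i; rewrite mem_index_iota /P => /andP[/norP[_ /negPf->]].
have TL : T <= sq (u - Y - Z).
  rewrite sqL [leRHS](@big_cat_nat _ _ _ M.+1)//= -[leLHS]add0r lerD//.
    by apply: sumr_ge0 => i _; exact: sqr_ge0.
  rewrite /T big_mkcond [leRHS]big_mkcond/= !big_nat.
  apply: ler_sum => i /andP[Mi _]; rewrite /P Mi orbT.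
  by case: ifP => // _; exact: sqr_ge0.
have HC : H <= C * sq u by exact: head.
have leY : sq Y <= C * K * sq u.
  apply: le_trans (ip_sq_sum_le _ _ _ _) _.
  by rewrite mulrAC ler_wpM2r.
have leZ : sq Z <= T / 6.
  apply: le_trans (ip_sq_sum_le _ _ _ _) _.
  by rewrite ler_wpM2l// sumr_ge0// => i _; exact: sqr_ge0.
have := ip_sqD_le3 u (- Y) (- Z); rewrite !ip_sqN -/(sq u) sumE; nra.
Qed.

End TriangularPerturbation.

End Orthonormal.

End SemiInner.

(** * The space L^2(0, pi) *)

Section L2.
Context {R : realType}.
Local Notation mu := (@lebesgue_measure R).
Local Notation I := (`]0, pi[%classic : set R).

Let mI : measurable I. Proof. exact: measurable_itv. Qed.

Lemma inL2P (f : R -> R) : inL2 f <->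
  measurable_fun I f /\ mu.-integrable I (fun x => (f x ^+ 2)%:E).
Proof.
have sqE : (fun x => (extend0 f x ^+ 2)%:E) = (fun x => (f x ^+ 2)%:E) \_ I.
  apply/funext => x; rewrite /extend0 /patch; case: ifP => // _.
  by rewrite expr0n.
have mE : measurable_fun setT (extend0 f) <-> measurable_fun I f.
  by rewrite /extend0 -measurable_restrictT.
split=> [L2f|[mf if2]].
  split.
    by move: L2f; rewrite /inL2 inE => /andP[]; rewrite inE/= => /mE.
  apply/(integrable_mkcond (mu:=mu) _ mI); rewrite -sqE.
  exact: Lfun2_integrable_sqr L2f.
have mf' : measurable_fun setT (extend0 f) by exact/mE.
rewrite /inL2 inE; apply/andP; split; rewrite inE//= /finite_norm unlock.
apply: poweR_lty.
under eq_integral => x _ do rewrite /= powR_mulrn// -normrX.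
have /(integrable_mkcond (mu:=mu) _ mI) := if2; rewrite -sqE => /integrableP[_].
by under eq_integral do rewrite /=.
Qed.

Lemma L2norm_sqr (f : R -> R) : L2norm f ^+ 2 = \int[mu]_(x in I) (f x ^+ 2).
Proof.
rewrite /L2norm unlock/= fine_poweR.
under eq_integral => x _ do rewrite /= powR_mulrn// -normrX ger0_norm ?sqr_ge0//.
rewrite -powR_mulrn ?powR_ge0// -powRrM mulVf// powRr1.
  rewrite [RHS]Rintegral_mkcond /Rintegral; congr fine.
  apply: eq_integral => x _; rewrite /extend0 /patch; case: ifP => // _.
  by rewrite expr0n.
by apply: fine_ge0; apply: integral_ge0 => x _; rewrite lee_fin sqr_ge0.
Qed.

Local Notation V := (LfunType mu (lee1n 2 : (1 <= 2%:E)%E)).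

(** The factor [2 / pi] makes the sines orthonormal. *)
Definition ipL2 (f g : R -> R) : R := 2 / pi * \int[mu]_(x in I) (f x * g x).

(** Elements of [V] are functions on the whole line, not classes modulo null sets, and the integral
    sees only []0, pi[]: this is a semi-inner product, not a definite one. *)
Definition ipV (f g : V) : R := ipL2 f g.

(** The default value [0] outside [inL2] makes the embedding total. *)
Definition toL2 (f : R -> R) : V :=
  if pselect (inL2 f) is left h then Lfun_Sub _ h else 0.

Lemma toL2E (f : R -> R) : inL2 f -> toL2 f = extend0 f :> (R -> R).
Proof. by rewrite /toL2; case: pselect. Qed.

Lemma toL2_in (f : R -> R) x : inL2 f -> x \in I -> toL2 f x = f x.
Proof. by move=> /toL2E -> xI; rewrite /extend0 patchE xI. Qed.

Lemma V_inL2 (f : V) : inL2 f.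
Proof.
have fL : (f : R -> R) \in Lfun mu 2%:E by exact: LfunP.
apply/inL2P; split.
  by move: fL; rewrite inE => /andP[]; rewrite inE/= => mf _; exact: measurable_funTS.
exact: integrableS (Lfun2_integrable_sqr fL).
Qed.

Lemma inL2_mul_integrable (f g : R -> R) : inL2 f -> inL2 g ->
  mu.-integrable I (fun x => (f x * g x)%:E).
Proof.
move=> f2 g2; apply/(integrable_mkcond (mu:=mu) _ mI).
rewrite (_ : _ \_ _ = EFin \o (extend0 f \* extend0 g)).
  exact/Lfun1_integrable/Lfun2_mul_Lfun1.
apply/funext => x; rewrite /extend0 /= !patchE; case: ifP => // _.
by rewrite mulr0.
Qed.

Lemma eq_ipL2 (f f' g g' : R -> R) : {in I, f =1 f'} -> {in I, g =1 g'} ->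
  ipL2 f g = ipL2 f' g'.
Proof.
by move=> ff' gg'; rewrite /ipL2; congr (_ * _); apply: eq_Rintegral => x xI; rewrite ff'// gg'.
Qed.

Lemma ipL2C (f g : V) : ipL2 f g = ipL2 g f.
Proof. by rewrite /ipL2; congr (_ * _); apply: eq_Rintegral => x _; rewrite mulrC. Qed.

Lemma ipL2Dl (f g h : V) : ipL2 (f + g : V) h = ipL2 f h + ipL2 g h.
Proof.
rewrite /ipL2 -mulrDr; congr (_ * _).
rewrite -RintegralD//; try by apply: inL2_mul_integrable; exact: V_inL2.
by apply: eq_Rintegral => x _ /=; rewrite mulrDl.
Qed.

Lemma ipL2Zl (a : R) (f g : V) : ipL2 (a *: f : V) g = a * ipL2 f g.
Proof.
rewrite /ipL2 mulrCA; congr (_ * _).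
rewrite -RintegralZl//; try by apply: inL2_mul_integrable; exact: V_inL2.
by apply: eq_Rintegral => x _ /=; rewrite mulrA.
Qed.

Lemma ipL2_ge0 (f : V) : 0 <= ipL2 f f.
Proof.
rewrite mulr_ge0 ?divr_ge0 ?pi_ge0//; apply: Rintegral_ge0 => x _.
by rewrite -expr2 sqr_ge0.
Qed.

Lemma L2norm_ipL2 (f : R -> R) : L2norm f ^+ 2 = pi / 2 * ipL2 f f.
Proof.
rewrite L2norm_sqr /ipL2 mulrA mulf_div [_ * 2]mulrC divff ?mul1r; last first.
  by rewrite mulf_neq0// gt_eqF// pi_gt0.
by apply: eq_Rintegral => x _; rewrite expr2.
Qed.

Lemma toL2_lincomb (psi : nat -> R -> R) N (a : nat -> R) x : x \in I ->
  (forall n, (0 < n)%N -> inL2 (psi n)) ->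
  (\sum_(1 <= n < N.+1) a n *: toL2 (psi n)) x = lincomb psi N a x.
Proof.
move=> xI psi2; rewrite /lincomb.
elim: N => [|N IH]; first by rewrite !big_geq.
rewrite big_nat_recr//= [RHS]big_nat_recr//= -IH.
by rewrite -[in RHS](toL2_in (psi2 N.+1 _) xI).
Qed.

Lemma bounded_inL2 (f : R -> R) (K : R) : measurable_fun I f ->
  (forall x, x \in I -> `|f x| <= K) -> inL2 f.
Proof.
move=> mf fK; apply/inL2P; split => //.
apply: (@le_integrable _ _ _ mu _ mI _ (cst (K ^+ 2)%:E)).
- by apply/measurable_EFinP; exact: measurable_funX.
- move=> x Ix /=; rewrite lee_fin normrX [leRHS]ger0_norm ?sqr_ge0//.
  have xI : x \in I by rewrite inE.
  by rewrite lerXn2r// ?nnegrE ?(le_trans _ (fK x xI)) ?fK.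
- apply/integrableP; split; first exact: measurable_cst.
  rewrite /= integral_cst//= lebesgue_measure_itv/= lte_fin pi_gt0.
  by rewrite -EFinB lte_mul_pinfty ?ltry.
Qed.

Lemma le_inL2 (f g : R -> R) : measurable_fun I f ->
  (forall x, x \in I -> `|f x| <= `|g x|) -> inL2 g -> inL2 f.
Proof.
move=> mf fg /inL2P[mg g2]; apply/inL2P; split => //.
apply: le_integrable g2 => //.
  by apply/measurable_EFinP; exact: measurable_funX.
move=> x Ix; rewrite lee_fin !normrX.
by rewrite lerXn2r// ?nnegrE// fg// inE.
Qed.

Lemma extend0D (f g : R -> R) : extend0 (f \+ g) = extend0 f \+ extend0 g.
Proof.
apply/funext => x; rewrite /extend0 /= !patchE; case: ifP => // _.
by rewrite addr0.
Qed.

Lemma extend0Z a (f : R -> R) : extend0 (fun x => a * f x) = (fun x => a * extend0 f x).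
Proof.
apply/funext => x; rewrite /extend0 /= !patchE; case: ifP => // _.
by rewrite mulr0.
Qed.

Lemma inL2D (f g : R -> R) : inL2 f -> inL2 g -> inL2 (f \+ g).
Proof.
move=> f2 g2; rewrite /inL2 extend0D -(toL2E f2) -(toL2E g2).
exact: (LfunP (toL2 f + toL2 g)).
Qed.

Lemma inL2Z a (f : R -> R) : inL2 f -> inL2 (fun x => a * f x).
Proof.
move=> f2; rewrite /inL2 extend0Z -(toL2E f2).
exact: (LfunP (a *: toL2 f)).
Qed.

Lemma toL2_eq (f g : R -> R) : inL2 f -> {in I, f =1 g} -> toL2 f = toL2 g.
Proof.
move=> f2 fg; have e : extend0 f = extend0 g.
  by apply/funext => x; rewrite /extend0 !patchE; case: ifPn => // /fg.
have g2 : inL2 g by rewrite /inL2 -e.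
by apply: val_inj => /=; rewrite !toL2E.
Qed.

Lemma toL2D (f g : R -> R) : inL2 f -> inL2 g -> toL2 (f \+ g) = toL2 f + toL2 g.
Proof.
move=> f2 g2; apply: val_inj => /=.
by rewrite (toL2E (inL2D f2 g2)) extend0D -(toL2E f2) -(toL2E g2).
Qed.

Lemma toL2Z a (f : R -> R) : inL2 f -> toL2 (fun x => a * f x) = a *: toL2 f.
Proof.
move=> f2; apply: val_inj => /=.
by rewrite (toL2E (inL2Z a f2)) extend0Z -(toL2E f2).
Qed.

Lemma toL2B (f g : R -> R) : inL2 f -> inL2 g -> toL2 (f \- g) = toL2 f - toL2 g.
Proof.
move=> f2 g2; rewrite -scaleN1r -toL2Z// -toL2D//; last exact: inL2Z.
by congr toL2; apply/funext => x /=; rewrite mulN1r.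
Qed.

Lemma inL2B (f g : R -> R) : inL2 f -> inL2 g -> inL2 (f \- g).
Proof.
move=> f2 g2; have -> : f \- g = f \+ (fun x => -1 * g x).
  by apply/funext => x /=; rewrite mulN1r.
by apply: inL2D => //; exact: inL2Z.
Qed.

End L2.

(** * The sine system *)

Section SineIntegrals.
Context {R : realType}.
Local Notation mu := (@lebesgue_measure R).

Lemma is_derive_sin_affine (p c x : R) :
  is_derive x (1 : R) (fun y => sin (p * (y - c))) (p * cos (p * (x - c))).
Proof.
have d : is_derive x (1 : R) (fun y => p * (y - c)) p.
  have -> : (fun y => p * (y - c)) = (p \*: (id - cst c)).
    by apply/funext => y.
  by apply: is_derive_eq; rewrite subr0 /GRing.scale/= mulr1.
by rewrite mulrC; exact: is_derive1_comp.
Qed.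

Lemma is_derive_cos_affine (p c x : R) :
  is_derive x (1 : R) (fun y => cos (p * (y - c))) (- p * sin (p * (x - c))).
Proof.
have d : is_derive x (1 : R) (fun y => p * (y - c)) p.
  have -> : (fun y => p * (y - c)) = (p \*: (id - cst c)).
    by apply/funext => y.
  by apply: is_derive_eq; rewrite subr0 /GRing.scale/= mulr1.
by rewrite mulNr mulrC -mulNr; exact: is_derive1_comp.
Qed.

Lemma is_derive_sinM (p x : R) :
  is_derive x (1 : R) (fun y => sin (p * y)) (p * cos (p * x)).
Proof.
have := is_derive_sin_affine p 0 x.
by under eq_fun do rewrite subr0; rewrite subr0.
Qed.

Lemma is_derive_cosM (p x : R) :
  is_derive x (1 : R) (fun y => cos (p * y)) (- p * sin (p * x)).
Proof.
have := is_derive_cos_affine p 0 x.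
by under eq_fun do rewrite subr0; rewrite subr0.
Qed.

Lemma continuous_sinM (p : R) : continuous (fun y => sin (p * y)).
Proof.
by move=> x; apply: differentiable_continuous; apply/derivable1_diffP;
  have [] := is_derive_sinM p x.
Qed.

Lemma continuous_sin_affine (p c : R) : continuous (fun y => sin (p * (y - c))).
Proof.
by move=> x; apply: differentiable_continuous; apply/derivable1_diffP;
  have [] := is_derive_sin_affine p c x.
Qed.

Lemma continuous_cos_affine (p c : R) : continuous (fun y => cos (p * (y - c))).
Proof.
by move=> x; apply: differentiable_continuous; apply/derivable1_diffP;
  have [] := is_derive_cos_affine p c x.
Qed.

Lemma Rintegral_FTC (f F : R -> R) (a b : R) : a < b ->
  (forall x, is_derive x (1 : R) F (f x)) -> continuous f ->
  \int[mu]_(x in `[a, b]) f x = F b - F a.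
Proof.
move=> ab dF cf; rewrite /Rintegral (continuous_FTC2 ab _ _ _ (F := F))//.
- exact: continuous_subspaceT.
- have cF : continuous F.
    by move=> x; apply: differentiable_continuous; apply/derivable1_diffP; case: (dF x).
  split.
  + by move=> x _; case: (dF x).
  + exact: cvg_at_right_filter (cF _).
  + exact: cvg_at_left_filter (cF _).
- by move=> x _; rewrite derive1E; case: (dF x).
Qed.

Lemma continuous_integrable (f : R -> R) (a b : R) :
  {within `[a, b], continuous f} -> mu.-integrable `[a, b] (EFin \o f).
Proof. by move=> cf; apply: continuous_compact_integrable => //; exact: segment_compact. Qed.

Lemma Rintegral_oo_cc (f : R -> R) (a b : R) : {within `[a, b], continuous f} ->
  \int[mu]_(x in `]a, b[) f x = \int[mu]_(x in `[a, b]) f x.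
Proof.
move=> /continuous_integrable fi; rewrite Rintegral_itv_bndo_bndc; last first.
  by apply: integrableS fi => //; apply: subset_itv; rewrite bnd_simp.
rewrite Rintegral_itv_obnd_cbnd//.
by apply: integrableS fi => //; apply: subset_itv; rewrite bnd_simp.
Qed.

(* Both sines solve [u'' = - k^2 u], so their Wronskian has derivative
   [(p^2 - q^2) sin (p x) sin (q x)]. *)
Lemma Rintegral_sin_sin (p q a b : R) : a < b ->
  (p ^+ 2 - q ^+ 2) * \int[mu]_(x in `[a, b]) (sin (p * x) * sin (q * x)) =
  (q * sin (p * b) * cos (q * b) - p * cos (p * b) * sin (q * b)) -
  (q * sin (p * a) * cos (q * a) - p * cos (p * a) * sin (q * a)).
Proof.
move=> ab.
have cc : continuous (fun x => sin (p * x) * sin (q * x)).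
  by move=> x; apply: cvgM; exact: continuous_sinM.
rewrite -RintegralZl//; last first.
  by apply: continuous_integrable; exact: continuous_subspaceT.
pose W x := q * sin (p * x) * cos (q * x) - p * cos (p * x) * sin (q * x).
rewrite -/(W b) -/(W a); apply: Rintegral_FTC => //; last first.
  by move=> x; apply: cvgM; [exact: cvg_cst|exact: cc].
move=> x.
have ds r := is_derive_sinM r x; have dc r := is_derive_cosM r x.
have -> : W = (q *: ((fun x : R => sin (p * x)) * (fun x => cos (q * x))))
     - (p *: ((fun x : R => cos (p * x)) * (fun x => sin (q * x)))).
  by apply/funext => y; rewrite /W -!mulrA.
apply: is_derive_eq; rewrite /GRing.scale/=; ring.
Qed.

Lemma Rintegral_sin_sqr (p a b : R) : p != 0 -> a < b ->
  \int[mu]_(x in `[a, b]) (sin (p * x) * sin (p * x)) =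
  (b / 2 - sin (p * b) * cos (p * b) / (2 * p)) -
  (a / 2 - sin (p * a) * cos (p * a) / (2 * p)).
Proof.
move=> p0 ab.
pose W x := x / 2 - sin (p * x) * cos (p * x) / (2 * p).
rewrite -/(W b) -/(W a); apply: Rintegral_FTC => //; last first.
  by move=> x; apply: cvgM; exact: continuous_sinM.
move=> x.
have ds r := is_derive_sinM r x; have dc r := is_derive_cosM r x.
have -> : W = (2^-1 *: id)
     - ((2 * p)^-1 *: ((fun x : R => sin (p * x)) * (fun x => cos (p * x)))).
  by apply/funext => y; rewrite /W /= /GRing.scale/=; rewrite mulrC; congr (_ - _); rewrite mulrC.
apply: is_derive_eq; rewrite /GRing.scale/=.
have := cos2Dsin2 (p * x) => h.
have -> : cos (p * x) * (p * cos (p * x)) = p * (1 - sin (p * x) ^+ 2) by rewrite -h; ring.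
by field.
Qed.

Lemma sin_natpi n : sin (n%:R * pi) = 0 :> R.
Proof.
elim: n => [|n IH]; first by rewrite mul0r sin0.
by rewrite -natr1 mulrDl mul1r sinD IH sinpi mul0r mulr0 addr0.
Qed.

End SineIntegrals.

(** * Orthonormality of the sines and sine polynomials *)

Section SineSystem.
Context {R : realType}.
Local Notation mu := (@lebesgue_measure R).
Local Notation I := (`]0, pi[%classic : set R).
Local Notation V := (LfunType mu (lee1n 2 : (1 <= 2%:E)%E)).

Let mI : measurable I. Proof. exact: measurable_itv. Qed.

Definition sine (n : nat) (x : R) : R := sin (n%:R * x).

Lemma measurable_sine n D : measurable_fun D (sine n).
Proof. by apply: measurable_funTS; apply: continuous_measurable_fun; exact: continuous_sinM. Qed.

Lemma sine_inL2 n : inL2 (sine n).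
Proof.
by apply: (@bounded_inL2 _ _ 1 (@measurable_sine n _)) => x _; rewrite ler_norml sin_geN1 sin_le1.
Qed.

Definition sineV (n : nat) : V := toL2 (sine n).

(** For [m != n], the boundary terms of the Wronskian identity vanish because the sines do at [0]
    and [pi], while [m^2 - n^2] is nonzero. *)
Lemma ipL2_sine m n : (0 < m)%N -> (0 < n)%N -> ipL2 (sine m) (sine n) = (m == n)%:R.
Proof.
move=> m0 n0; rewrite /ipL2 Rintegral_oo_cc; last first.
  by apply: continuous_subspaceT => x; apply: cvgM; exact: continuous_sinM.
have [->|mn] := eqVneq m n.
  rewrite Rintegral_sin_sqr ?pi_gt0//; last by rewrite pnatr_eq0 -lt0n.
  rewrite sin_natpi mulr0 sin0 !mul0r !subr0 mulf_div [pi * 2]mulrC divff//.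
  by rewrite mulf_neq0// gt_eqF ?pi_gt0.
apply/eqP; rewrite mulf_eq0; apply/orP; right.
have /eqP := @Rintegral_sin_sin R m%:R n%:R 0 pi (pi_gt0 R).
rewrite !sin_natpi !mulr0 sin0 !(mulr0, mul0r) !subr0 mulf_eq0 => /orP[|//].
rewrite subr_eq0 eqrXn2// ?eqr_nat ?(negPf mn)//.
Qed.

Lemma ipV_sine m n : (0 < m)%N -> (0 < n)%N -> ipV (sineV m) (sineV n) = (m == n)%:R.
Proof.
move=> m0 n0; rewrite -ipL2_sine//; apply: eq_ipL2 => x xI; exact: toL2_in (sine_inL2 _) xI.
Qed.

Local Notation in_sine_span := (in_closed_span ipV sineV).

Let sine_spanD (f g : V) : in_sine_span f -> in_sine_span g -> in_sine_span (f + g).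
Proof. exact: (in_closed_spanD (ip := ipV) (@ipL2C R) (@ipL2Dl R) (@ipL2Zl R) (@ipL2_ge0 R)). Qed.

Let sine_spanZ a (f : V) : in_sine_span f -> in_sine_span (a *: f).
Proof. exact: (in_closed_spanZ (ip := ipV) (@ipL2C R) (@ipL2Zl R) (@ipL2_ge0 R)). Qed.

Let sine_spanc (f : V) :
  (forall d, 0 < d -> exists2 g, in_sine_span g & ipV (f - g) (f - g) < d) ->
  in_sine_span f.
Proof. exact: (in_closed_span_closed (ip := ipV) (@ipL2C R) (@ipL2Dl R) (@ipL2Zl R) (@ipL2_ge0 R)). Qed.

Let sine_span_span f : in_span sineV f -> in_sine_span f.
Proof. exact: (in_closed_span_span (ip := ipV) (@ipL2Zl R)). Qed.

Lemma continuous_inL2 (f : R -> R) : {within `[0, pi], continuous f} -> inL2 f.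
Proof.
move=> cf; have I0 : I `<=` `[0, pi] by apply: subset_itv; rewrite bnd_simp.
apply/inL2P; split.
  apply: (measurable_funS (measurable_itv `[0, pi])) I0 _.
  by apply: subspace_continuous_measurable_fun cf; exact: measurable_itv.
apply: (@integrableS _ _ _ mu `[0, pi] I) => //; apply: continuous_integrable => x.
exact: (continuous_comp (cf x) (@exprn_continuous R 2 (f x))).
Qed.

Lemma ipV_toL2B (f g : R -> R) : inL2 f -> inL2 g ->
  ipV (toL2 f - toL2 g) (toL2 f - toL2 g) = 2 / pi * \int[mu]_(x in I) (f x - g x) ^+ 2.
Proof.
move=> f2 g2; rewrite -toL2B// /ipV (@eq_ipL2 _ _ (f \- g) _ (f \- g)); first last.
- by move=> x; apply: toL2_in; exact: inL2B.
- by move=> x; apply: toL2_in; exact: inL2B.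
- by rewrite /ipL2; congr (_ * _); apply: eq_Rintegral => x _; rewrite expr2.
Qed.

(** Dominated convergence for [(f - f_ n) ^+ 2], with bound [g ^+ 2], upgrades almost everywhere
    convergence to convergence in [V]. *)
Lemma sine_span_dominated (f_ : nat -> R -> R) (f g : R -> R) :
  (forall n, inL2 (f_ n)) -> (forall n, in_sine_span (toL2 (f_ n))) -> inL2 f -> inL2 g ->
  {ae mu, forall x, I x -> f_ n x @[n --> \oo] --> f x} ->
  (forall n x, x \in I -> `|f x - f_ n x| <= `|g x|) ->
  in_sine_span (toL2 f).
Proof.
move=> f_2 csf f2 g2 f_f fg; apply: sine_spanc => d d0.
have meas n : measurable_fun I (fun x => ((f x - f_ n x) ^+ 2)%:E).
  apply/measurable_EFinP; apply: measurable_funX.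
  by have /inL2P[] := inL2B f2 (f_2 n).
have /inL2P[_ gi] := g2.
have [||_ _] := dominated_convergence (mu:=mu) mI meas (@measurable_cst _ _ _ _ I 0%E) _ gi _.
- apply: filterS f_f; first exact: (ae_filter_ringOfSetsType mu).
  move=> x f_f Ix.
  apply: cvg_EFin; first exact: nearW.
  rewrite [X in _ --> X](_ : _ = (f x - f x) ^+ 2); last by rewrite subrr expr0n.
  under eq_fun do rewrite /= expr2; rewrite expr2.
  by apply: cvgM; apply: cvgB; do ?[exact: cvg_cst|exact: f_f].
- apply/aeW => x n Ix; have xI : x \in I by rewrite inE.
  rewrite lee_fin normrX -(real_normK (num_real (g x))).
  by rewrite lerXn2r// ?nnegrE//; exact: fg.
rewrite integral0 => /fine_cvg /= /cvgrPdist_lt h.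
have d' : 0 < d * (pi / 2) by rewrite mulr_gt0// divr_gt0// pi_gt0.
have [N _ /(_ N (leqnn N))] := h _ d'; rewrite sub0r normrN => /ltr_normlW hN.
exists (toL2 (f_ N)) => //.
rewrite ipV_toL2B//.
rewrite -ltr_pdivlMl ?divr_gt0 ?pi_gt0//.
by rewrite invf_div mulrC.
Qed.

Lemma sine_span_D f g : inL2 f -> inL2 g ->
  in_sine_span (toL2 f) -> in_sine_span (toL2 g) -> in_sine_span (toL2 (f \+ g)).
Proof. by move=> f2 g2 csf csg; rewrite (toL2D f2 g2); exact: sine_spanD csf csg. Qed.

Lemma sine_span_Z a f : inL2 f -> in_sine_span (toL2 f) -> in_sine_span (toL2 (fun x => a * f x)).
Proof. by move=> f2 csf; rewrite (toL2Z a f2); exact: sine_spanZ csf. Qed.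

Lemma inL2_eq f g : {in I, f =1 g} -> inL2 f -> inL2 g.
Proof.
move=> fg; rewrite /inL2 (_ : extend0 g = extend0 f)//.
by apply/funext => x; rewrite /extend0 !patchE; case: ifPn => // /fg.
Qed.

Lemma sine_span_eq f g : inL2 f -> {in I, f =1 g} -> in_sine_span (toL2 f) -> in_sine_span (toL2 g).
Proof. by move=> f2 fg; rewrite (toL2_eq f2 fg). Qed.

Lemma sine_span_0 : in_sine_span (toL2 (fun=> 0)).
Proof.
have -> : toL2 (fun=> 0 : R) = 0 *: sineV 1.
  by rewrite /sineV -toL2Z; [congr toL2; apply/funext => x; rewrite mul0r|exact: sine_inL2].
by apply: sine_spanZ; apply: sine_span_span; exact: in_span_mem.
Qed.

Lemma sine_span_sine n : in_sine_span (sineV n).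
Proof.
case: n => [|n]; last by apply: sine_span_span; exact: in_span_mem.
rewrite /sineV (_ : sine 0 = fun=> 0); first exact: sine_span_0.
by apply/funext => x; rewrite /sine mul0r sin0.
Qed.

Let sine_cos_inL2 n k : inL2 (fun x : R => sine n x * cos x ^+ k).
Proof.
apply: continuous_inL2; apply: continuous_subspaceT => x; apply: cvgM.
  exact: continuous_sinM.
exact: (continuous_comp (@continuous_cos R x) (@exprn_continuous R k (cos x))).
Qed.

(** Factors [cos x] are removed one at a time by [2 sin ((n + 1) x) cos x = sin ((n + 2) x) + sin (n
    x)]. *)
Lemma sine_span_sine_cos n k : in_sine_span (toL2 (fun x => sine n x * cos x ^+ k)).
Proof.
elim: k n => [|k IH] [|n].
- by under eq_fun do rewrite expr0 mulr1; exact: sine_span_sine.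
- by under eq_fun do rewrite expr0 mulr1; exact: sine_span_sine.
- by under eq_fun do rewrite /sine mul0r sin0 mul0r; exact: sine_span_0.
pose f m x := sine m x * cos x ^+ k : R.
have -> : (fun x : R => sine n.+1 x * cos x ^+ k.+1) =
    (fun x => 2^-1 * (f n.+2 \+ f n) x).
  apply/funext => x /=.
  have e2 : sine n.+2 x = sin (n.+1%:R * x) * cos x + cos (n.+1%:R * x) * sin x.
    by rewrite /sine -[n.+2%:R]natr1 mulrDl mul1r sinD.
  have e0 : sine n x = sin (n.+1%:R * x) * cos x - cos (n.+1%:R * x) * sin x.
    by rewrite -sinB /sine -[n.+1%:R]natr1 mulrDl mul1r addrK.
  by rewrite /f e2 e0 exprS /sine; field.
have f2 m : inL2 (f m) by exact: sine_cos_inL2.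
apply: (@sine_span_Z _ (f n.+2 \+ f n)); first exact: inL2D.
by apply: sine_span_D => //; exact: IH.
Qed.

Lemma sin_poly_inL2 (p : {poly R}) : inL2 (fun x : R => sin x * p.[cos x]).
Proof.
apply: continuous_inL2; apply: continuous_subspaceT => x; apply: cvgM.
  exact: continuous_sin.
exact: (continuous_comp (@continuous_cos R x) (@continuous_horner R p (cos x))).
Qed.

Lemma sine_span_sin_poly (p : {poly R}) : in_sine_span (toL2 (fun x => sin x * p.[cos x])).
Proof.
have h n : inL2 (fun x : R => \sum_(i < n) p`_i * (sine 1 x * cos x ^+ i)) /\
    in_sine_span (toL2 (fun x => \sum_(i < n) p`_i * (sine 1 x * cos x ^+ i))).
  elim: n => [|n [IH1 IH2]].
    under eq_fun do rewrite big_ord0; split; last exact: sine_span_0.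
    by apply: continuous_inL2; apply: continuous_subspaceT => x; exact: cvg_cst.
  have -> : (fun x : R => \sum_(i < n.+1) p`_i * (sine 1 x * cos x ^+ i)) =
    (fun x => \sum_(i < n) p`_i * (sine 1 x * cos x ^+ i)) \+
    (fun x => p`_n * (sine 1 x * cos x ^+ n)).
    by apply/funext => x; rewrite big_ord_recr.
  have n2 := sine_cos_inL2 1 n.
  split; first exact: inL2D IH1 (inL2Z _ n2).
  exact: sine_span_D IH1 (inL2Z _ n2) IH2 (sine_span_Z p`_n n2 (sine_span_sine_cos 1 n)).
have [_] := h (size p); congr (in_sine_span (toL2 _)); apply/funext => x.
rewrite horner_coef mulr_sumr; apply: eq_bigr => i _.
by rewrite /sine mul1r mulrCA.
Qed.

End SineSystem.

(** * Polynomials converging to a step at 1/2 *)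

Section Thresholds.
Context {R : realType}.
Implicit Types t y : R.

(** Bernoulli's inequality. *)
Lemma expr_onem_ge t k : 0 <= t <= 1 -> 1 - k%:R * t <= (1 - t) ^+ k.
Proof.
move=> /andP[t0 t1]; elim: k => [|k IH]; first by rewrite mul0r subr0 expr0.
have : (1 - t) * (1 - k%:R * t) <= (1 - t) ^+ k.+1.
  by rewrite exprS ler_wpM2l// subr_ge0.
have := mulr_ge0 (mulr_ge0 (ler0n R k) t0) t0; rewrite -natr1; lra.
Qed.

(** An upper companion of Bernoulli's inequality, by induction from [(1 - t) (1 + (k + 1) t) = 1 + k
    t - (k + 1) t^2]. *)
Lemma expr_onem_le t k : 0 <= t <= 1 -> (1 - t) ^+ k * (1 + k%:R * t) <= 1.
Proof.
move=> /andP[t0 t1]; elim: k => [|k IH]; first by rewrite mul0r addr0 expr0 mulr1.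
apply: le_trans IH; rewrite exprSr -mulrA ler_wpM2l ?exprn_ge0 ?subr_ge0//.
have := mulr_ge0 (mulr_ge0 (ler0n R k) t0) t0; rewrite -natr1; nra.
Qed.

(* [(1 - y^n)^(2^n)] behaves like [exp (- (2 y)^n)]. *)
Definition threshold n y := (1 - y ^+ n) ^+ (2 ^ n).

Lemma threshold_itv n y : 0 <= y <= 1 -> 0 <= threshold n y <= 1.
Proof.
move=> /andP[y0 y1]; have yn0 : 0 <= y ^+ n by exact: exprn_ge0.
have yn1 : y ^+ n <= 1 by exact: exprn_ile1.
by rewrite exprn_ge0 ?subr_ge0//= exprn_ile1 ?subr_ge0// lerBlDr lerDl.
Qed.

(** Bernoulli's inequality bounds the power below by [1 - 2^n y^n = 1 - (2 y)^n], and here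
    [2 y < 1]. *)
Lemma threshold_lt y : 0 <= y < 2^-1 -> threshold n y @[n --> \oo] --> (1 : R).
Proof.
move=> /andP[y0 y2]; have y1 : y <= 1 by lra.
have y01 : 0 <= y <= 1 by rewrite y0.
have c0 : (2 * y) ^+ n @[n --> \oo] --> (0 : R).
  by apply: cvg_expr; rewrite ger0_norm; lra.
have c1 : 1 - (2 * y) ^+ n @[n --> \oo] --> (1 : R).
  by rewrite -[X in _ --> X]subr0; apply: cvgB => //; exact: cvg_cst.
apply: (squeeze_cvgr _ c1 (cvg_cst (1 : R))); apply: nearW => n.
have /andP[_ ->] := threshold_itv n y01; rewrite andbT exprMn -natrX.
by apply: expr_onem_ge; rewrite exprn_ge0//= exprn_ile1.
Qed.

(** The power is at most [1 / (1 + (2 y)^n)], hence at most [(2 y)^-n], and here [2 y > 1]. *)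
Lemma threshold_gt y : 2^-1 < y <= 1 -> threshold n y @[n --> \oo] --> (0 : R).
Proof.
move=> /andP[y2 y1]; have y0 : 0 <= y by lra.
have y01 : 0 <= y <= 1 by rewrite y0.
have c0 : (2 * y)^-1 ^+ n @[n --> \oo] --> (0 : R).
  apply: cvg_expr; rewrite ger0_norm ?invr_ge0 ?mulr_ge0//.
  by rewrite invf_lt1; lra.
apply: (squeeze_cvgr _ (cvg_cst (0 : R)) c0); apply: nearW => n.
have /andP[t0 _] := threshold_itv n y01; rewrite t0/=.
have p0 : 0 < (2 * y) ^+ n by apply: exprn_gt0; lra.
rewrite exprVn -[leRHS]mul1r ler_pdivlMr//.
have t01 : 0 <= y ^+ n <= 1 by rewrite exprn_ge0//= exprn_ile1.
apply: le_trans (expr_onem_le (2 ^ n) t01).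
by rewrite ler_wpM2l// exprMn -natrX lerDr.
Qed.

End Thresholds.

(** * Completeness of the sines *)

Section SineComplete.
Context {R : realType}.
Local Notation mu := (@lebesgue_measure R).
Local Notation I := (`]0, pi[%classic : set R).
Local Notation V := (LfunType mu (lee1n 2 : (1 <= 2%:E)%E)).
Local Notation in_sine_span := (in_closed_span ipV sineV).

Let mI : measurable I. Proof. exact: measurable_itv. Qed.

Let sinI (A : set R) (x : R) := sin x * \1_A x.

Let cst1_inL2 : inL2 (fun _ : R => 1 : R).
Proof. by apply: continuous_inL2; apply: continuous_subspaceT => x; exact: cvg_cst. Qed.

Let sinI_inL2 (A : set R) : measurable A -> inL2 (sinI A).
Proof.
move=> mA; apply: (@bounded_inL2 _ _ 1).
  apply: measurable_funM; last exact: measurable_indic.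
  by apply: measurable_funTS; apply: continuous_measurable_fun; exact: continuous_sin.
move=> x _; rewrite /sinI normrM indicE; case: (x \in A); rewrite ?normr1 ?normr0 ?mulr1 ?mulr0//.
by rewrite ler_norml sin_geN1 sin_le1.
Qed.

(** Since [cos] decreases on [[0, pi]], the condition [x > c] reads [cos x < cos c]. An affine
    function of [cos x] turns it into being below 1/2, where the threshold polynomials apply. *)
Lemma sine_span_ray (c : R) : in_sine_span (toL2 (sinI `]c, +oo[)).
Proof.
have mc : measurable (`]c, +oo[%classic : set R) by exact: measurable_itv.
have sin1 : in_sine_span (toL2 (sine 1 : R -> R)) := sine_span_sine 1.
have [c0|c0] := leP c 0.
  apply: (sine_span_eq (sine_inL2 1)) sin1 => x; rewrite inE/= in_itv/= => /andP[x0 _].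
  by rewrite /sinI indicE mem_set ?mulr1 ?/sine ?mul1r//= in_itv/= andbT (le_lt_trans c0).
have [cpi|cpi] := leP pi c.
  apply: sine_span_eq sine_span_0.
    by apply: continuous_inL2; apply: continuous_subspaceT => x; exact: cvg_cst.
  move=> x; rewrite inE/= in_itv/= => /andP[_ xpi].
  rewrite /sinI indicE memNset ?mulr0//= in_itv/= andbT; apply/negP; rewrite -leNgt.
  by rewrite ltW// (lt_le_trans xpi).
(* As [|cos x - cos c| <= 2], the slope 1/4 keeps the values in [[0, 1]], and the value 1/2 is taken
   exactly when [cos x = cos c]. *)
pose q : {poly R} := (2^-1 - cos c / 4)%:P + 4^-1 *: 'X.
pose p n := (1 - q ^+ n) ^+ (2 ^ n).
pose y (x : R) := 2^-1 + (cos x - cos c) / 4.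
have pE n x : (p n).[cos x] = threshold n (y x).
  have qE : q.[cos x] = y x by rewrite /q !hornerE /y; ring.
  by rewrite /p /threshold horner_exp hornerD hornerN horner_exp qE hornerC.
have y01 x : 0 <= y x <= 1.
  have := cos_geN1 x; have := cos_le1 x; have := cos_geN1 c; have := cos_le1 c.
  by rewrite /y => *; apply/andP; split; lra.
have cI : c \in `[0, pi]%R by rewrite in_itv/= !ltW.
have oc x : I x -> x \in `[0, pi]%R.
  by rewrite /= !in_itv/= => /andP[x0 xpi]; rewrite !ltW.
have yc x : I x -> (y x < 2^-1) = (c < x).
  by move=> /oc Ix; rewrite -(ltr_cos cI Ix) /y; apply/idP/idP => *; lra.
have yc' x : I x -> (2^-1 < y x) = (x < c).
  by move=> /oc Ix; rewrite -(ltr_cos Ix cI) /y; apply/idP/idP => *; lra.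
have ae_lim : {ae mu, forall x, I x ->
    sin x * (p n).[cos x] @[n --> \oo] --> sinI `]c, +oo[ x}.
  (* Only [x = c], where the threshold is evaluated at 1/2, is excluded. *)
  exists [set c]; split; [exact: measurable_set1|exact: lebesgue_measure_set1|].
  move=> x /= h; apply: contrapT => xc; apply: h => Ix.
  rewrite /sinI; apply: cvgM; first exact: cvg_cst.
  under eq_fun do rewrite pE.
  rewrite indicE; have [cx|xc'] := ltP c x.
    rewrite mem_set/= ?in_itv/= ?cx//; apply: threshold_lt.
    by rewrite yc// cx andbT; case/andP: (y01 x).
  rewrite memNset/= ?in_itv/= ?andbT; last by apply/negP; rewrite -leNgt.
  apply: threshold_gt; rewrite yc'//; case/andP: (y01 x) => _ ->; rewrite andbT.
  by rewrite lt_neqAle xc' andbT; apply/eqP.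
apply: (sine_span_dominated (g := fun=> 1)) (sinI_inL2 mc) cst1_inL2 ae_lim _.
- by move=> n; exact: sin_poly_inL2.
- by move=> n; exact: sine_span_sin_poly.
- move=> n x _; rewrite /sinI -mulrBr normr1 normrM -[leRHS]mulr1.
  rewrite ler_pM//; first by rewrite ler_norml sin_geN1 sin_le1.
  rewrite pE; have /andP[t0 t1] := threshold_itv n (y01 x).
  by rewrite indicE ler_norml; case: (x \in _) => /=; apply/andP; split; lra.
Qed.

(** Dynkin induction: the open right rays are stable under intersection and generate the Borel sets.
    Complements are handled by subtraction from [sin x], disjoint unions by dominated
    convergence. *)
Lemma sine_span_measurable (A : set R) : measurable A -> in_sine_span (toL2 (sinI A)).
Proof.
have mE : (@ocitv R).-sigma.-measurable = <<s @RGenOInfty.G R >> by exact: RGenOInfty.measurableE.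
move=> mA; have : <<s @RGenOInfty.G R >> A by rewrite -mE.
move: A {mA}; apply: (dynkin_induction (P := fun A => in_sine_span (toL2 (sinI A))) mE).
- move=> _ _ [x ->] [z ->]; exists (Num.max x z).
  apply/seteqP; split => t; rewrite /= !in_itv/= !andbT gt_max.
    by move=> [-> ->].
  by move=> /andP[-> ->].
- have -> : sinI setT = sine 1; last exact: sine_span_sine.
  by apply/funext => x; rewrite /sinI indicE in_setT mulr1 /sine mul1r.
- by move=> _ [x ->]; exact: sine_span_ray.
- move=> A mA csA; have -> : sinI (~` A) = sine 1 \+ (fun x => -1 * sinI A x).
    apply/funext => x; rewrite /sinI /= !indicE in_setC /sine mul1r.
    by case: (x \in A) => /=; ring.
  have A2 := sinI_inL2 mA.
  exact: sine_span_D (sine_inL2 1) (inL2Z _ A2) (sine_span_sine 1) (sine_span_Z _ A2 csA).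
move=> F mF tF csF.
pose f n x := \sum_(k < n) sinI (F k) x.
have fS n : f n.+1 = f n \+ sinI (F n) by apply/funext => x; rewrite /f big_ord_recr.
have f0 : f 0%N = fun=> 0 by apply/funext => x; rewrite /f big_ord0.
have f2 n : inL2 (f n).
  elim: n => [|n IH]; last by rewrite fS; exact: inL2D IH (sinI_inL2 (mF n)).
  by rewrite f0; apply: continuous_inL2; apply: continuous_subspaceT => x; exact: cvg_cst.
have csf n : in_sine_span (toL2 (f n)).
  elim: n => [|n IH]; first by rewrite f0; exact: sine_span_0.
  by rewrite fS; exact: sine_span_D (f2 n) (sinI_inL2 (mF n)) IH (csF n).
(* The sets are disjoint, so at [x] no term but the one of index [k] can be nonzero. *)
have fE n x k : F k x -> f n x = if (k < n)%N then sin x else 0.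
  move=> Fkx; have Fj j : j != k -> sinI (F j) x = 0.
    move=> jk; rewrite /sinI indicE memNset ?mulr0// => Fjx.
    by move/trivIsetP : tF => /(_ j k Logic.I Logic.I jk) /seteqP[/(_ x)] h _; apply: h.
  have [kn|nk] := ltnP k n.
    rewrite /f (bigD1 (Ordinal kn))//= big1 ?addr0.
      by rewrite /sinI indicE mem_set ?mulr1.
    by move=> j jk; apply: Fj; apply: contraNneq jk => jk; apply/eqP/val_inj.
  rewrite /f big1// => j _; apply: Fj; apply/eqP => jk.
  by move: (ltn_ord j); rewrite jk ltnNge nk.
have fE0 n x : ~ (\bigcup_k F k) x -> f n x = 0.
  move=> nF; rewrite /f big1// => j _; rewrite /sinI indicE memNset ?mulr0// => Fjx.
  by apply: nF; exists j.
have mU : measurable (\bigcup_k F k) by exact: bigcupT_measurable.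
apply: (sine_span_dominated f2 csf (sinI_inL2 mU) cst1_inL2).
  apply: aeW => x _; have [[k _ Fkx]|nF] := pselect ((\bigcup_k F k) x).
    rewrite /sinI indicE mem_set; last by exists k.
    rewrite mulr1; apply: cvg_near_cst; exists k.+1 => // n /= kn.
    by rewrite (fE _ _ _ Fkx) kn.
  rewrite /sinI indicE memNset// mulr0; apply: cvg_near_cst; apply: nearW => n.
  by rewrite fE0.
move=> n x _; rewrite normr1; have s1 : `|sin x| <= 1 by rewrite ler_norml sin_geN1 sin_le1.
have [[k _ Fkx]|nF] := pselect ((\bigcup_k F k) x).
  rewrite /sinI indicE mem_set; last by exists k.
  rewrite (fE _ _ _ Fkx) mulr1; case: ifP => _; last by rewrite subr0.
  by rewrite subrr normr0.
by rewrite /sinI indicE memNset// mulr0 fE0// subrr normr0.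
Qed.

Import HBNNSimple.

Lemma sine_span_nnsfun (phi : {nnsfun R >-> R}) :
  inL2 (fun x => sin x * phi x) /\ in_sine_span (toL2 (fun x => sin x * phi x)).
Proof.
have m1 y : measurable (phi @^-1` [set y]) by exact: measurable_sfunP.
have h (s : seq R) : inL2 (fun x => \sum_(y <- s) y * sinI (phi @^-1` [set y]) x) /\
    in_sine_span (toL2 (fun x => \sum_(y <- s) y * sinI (phi @^-1` [set y]) x)).
  elim: s => [|y s [IH1 IH2]].
    under eq_fun do rewrite big_nil; split; last exact: sine_span_0.
    by apply: continuous_inL2; apply: continuous_subspaceT => x; exact: cvg_cst.
  have -> : (fun x => \sum_(z <- y :: s) z * sinI (phi @^-1` [set z]) x) =
      (fun x => y * sinI (phi @^-1` [set y]) x) \+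
      (fun x => \sum_(z <- s) z * sinI (phi @^-1` [set z]) x).
    by apply/funext => x; rewrite big_cons.
  have y2 := sinI_inL2 (m1 y); split; first exact: inL2D (inL2Z _ y2) IH1.
  exact: sine_span_D (inL2Z _ y2) IH1 (sine_span_Z y y2 (sine_span_measurable (m1 y))) IH2.
have [s sE] : exists s : seq R, forall x, phi x = \sum_(y <- s) y * \1_(phi @^-1` [set y]) x.
  by eexists => x; rewrite [LHS]fimfunE fsbig_finite//=; exact: fimfunP.
have -> : (fun x => sin x * phi x) = (fun x => \sum_(y <- s) y * sinI (phi @^-1` [set y]) x).
  apply/funext => x; rewrite sE mulr_sumr.
  by apply: eq_bigr => y _; rewrite /sinI mulrCA.
exact: h.
Qed.

(** On []0, pi[] the sine is positive, so [f = sin x * h x] with [h = f / sin]. Simple functions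
    increasing to [h] give approximations that stay between [0] and [f], hence dominated by [f] even
    if [h] is not square integrable. *)
Lemma sine_span_ge0 (f : R -> R) : inL2 f -> (forall x, 0 <= f x) -> in_sine_span (toL2 f).
Proof.
move=> f2 f0; have /inL2P[mf _] := f2.
have msin D : measurable_fun D (@sin R).
  by apply: measurable_funTS; apply: continuous_measurable_fun; exact: continuous_sin.
have sin0 x : I x -> 0 < sin x by rewrite /= in_itv/=; exact: sin_gt0_pi.
have mh : measurable_fun I (fun x => (f x / sin x)%:E).
  apply/measurable_EFinP; apply: measurable_funM => //.
  apply: open_continuous_measurable_fun; first exact: interval_open.
  move=> x; rewrite inE => /sin0 sx; apply: cvgV; first by rewrite gt_eqF.
  exact: continuous_sin.
have h0 x : I x -> (0 <= (f x / sin x)%:E)%E.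
  by move=> Ix; rewrite lee_fin divr_ge0// ltW// sin0.
pose phi := nnsfun_approx mI mh.
have phi_cvg x : I x -> phi n x @[n --> \oo] --> f x / sin x.
  by move=> Ix; have /fine_cvg := cvg_nnsfun_approx mI mh h0 Ix.
have phi_le n x : I x -> phi n x <= f x / sin x.
  move=> Ix; rewrite -(cvg_lim _ (phi_cvg x Ix))//; apply: nondecreasing_cvgn_le.
    by move=> m k mk; exact/lefP/nd_nnsfun_approx.
  by apply/cvg_ex; exists (f x / sin x); exact: phi_cvg.
have H n := sine_span_nnsfun (phi n).
apply: (sine_span_dominated (fun n => (H n).1) (fun n => (H n).2) f2 f2).
  apply: aeW => x Ix; have sx := sin0 x Ix.
  rewrite -[X in _ --> X](divfK (lt0r_neq0 sx)) mulrC; apply: cvgM; first exact: cvg_cst.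
  exact: phi_cvg.
move=> n x; rewrite inE => Ix; have sx := sin0 x Ix.
have := phi_le n x Ix; rewrite ler_pdivlMr// => le1.
have : 0 <= phi n x by exact: fun_ge0.
move=> /(mulr_ge0 (ltW sx)) ge1; rewrite (ger0_norm (f0 x)) ger0_norm; lra.
Qed.

Lemma sineV_complete (f : V) : in_sine_span f.
Proof.
have f2 := V_inL2 f; have /inL2P[mf _] := f2.
have p2 : inL2 (f^\+ : R -> R).
  apply: (le_inL2 (g := f)) => //; first exact: measurable_funrpos.
  by move=> x _; rewrite /funrpos ger0_norm ?le_max ?lexx ?orbT// ge_max ler_norm normr_ge0.
have n2 : inL2 (f^\- : R -> R).
  apply: (le_inL2 (g := f)) => //; first exact: measurable_funrneg.
  by move=> x _; rewrite /funrneg ger0_norm ?le_max ?lexx ?orbT// ge_max -normrN ler_norm normr_ge0.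
have fE : (f : R -> R) = (f^\+ : R -> R) \+ (fun x => -1 * (f^\- : R -> R) x).
  by apply/funext => x /=; rewrite mulN1r -(congr1 (fun g => g x) (funrposBneg (f : R -> R))).
have csf : in_sine_span (toL2 f).
  rewrite fE; apply: sine_span_D => //.
  - exact: inL2Z.
  - by apply: sine_span_ge0 => // x; exact: funrpos_ge0.
  - by apply: sine_span_Z => //; apply: sine_span_ge0 => // x; exact: funrneg_ge0.
apply: (in_closed_span_closed (ip := ipV) (@ipL2C R) (@ipL2Dl R) (@ipL2Zl R) (@ipL2_ge0 R)).
(* [f] may be nonzero outside []0, pi[], so [f] and [toL2 f] may differ as vectors, but their
   distance is zero. *)
move=> d d0; exists (toL2 f); first exact: csf.
have f0 : {in I, (f - toL2 f : V) =1 fun=> 0}.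
  by move=> x xI; rewrite -[LHS]/(f x - toL2 f x) (toL2_in f2 xI) subrr.
change (ipV (f - toL2 f) (f - toL2 f) < d).
rewrite /ipV (eq_ipL2 f0 f0) /ipL2.
by under eq_Rintegral do rewrite mul0r; rewrite Rintegral_cst// mul0r mulr0.
Qed.

End SineComplete.

(** * Fucik eigenfunctions *)

Section Uniqueness.
Context {R : realType}.

(** The autonomous equation [u'' = - g (u)], written as a first-order system for [u] and
    [u1 = u']. *)
Definition ode2_on (g : R -> R) (a b : R) (u u1 : R -> R) : Prop :=
  [/\ {within `[a, b], continuous u}, {within `[a, b], continuous u1} &
      forall x, x \in `]a, b[ ->
        is_derive x (1 : R) u (u1 x) /\ is_derive x (1 : R) u1 (- g (u x))].

Lemma ode2_on_sub (g : R -> R) (a b c d : R) u u1 : a <= c -> d <= b ->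
  ode2_on g a b u u1 -> ode2_on g c d u u1.
Proof.
move=> ac db [cu cu1 du].
have sub : `[c, d] `<=` `[a, b] by apply: subset_itv; rewrite bnd_simp.
split; [exact: continuous_subspaceW cu|exact: continuous_subspaceW cu1|].
by move=> x xcd; apply: du; apply: subset_itv xcd; rewrite bnd_simp.
Qed.

(* Gronwall: [(|u - v|^2 + |u' - v'|^2) exp (- (1 + L) x)] is nonincreasing. *)
Lemma ode2_unique (g : R -> R) (L a b : R) (u u1 v v1 : R -> R) :
  (forall x y, `|g x - g y| <= L * `|x - y|) ->
  ode2_on g a b u u1 -> ode2_on g a b v v1 -> u a = v a -> u1 a = v1 a ->
  forall x, x \in `[a, b] -> u x = v x /\ u1 x = v1 x.
Proof.
move=> lip [cu cu1 du] [cv cv1 dv] ua u1a x xab.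
(* The term [2 p q] costs at most [p^2 + q^2] and the Lipschitz term at most [L (p^2 + q^2)], so
   this decay rate makes the derivative of [E] nonpositive. *)
pose K := 1 + L.
pose p := u - v; pose q := u1 - v1.
pose E : R -> R := (p * p + q * q) * (expR \o (fun x => - K * x)).
pose dE z := (2 * p z * q z - 2 * q z * (g (u z) - g (v z)) - K * (p z ^+ 2 + q z ^+ 2))
   * expR (- K * z).
have derE z : z \in `]a, b[ -> is_derive z (1 : R) E (dE z).
  move=> zab; have [du0 du1] := du z zab; have [dv0 dv1] := dv z zab.
  have dK : is_derive z (1 : R) (fun x : R => - K * x) (- K).
    have -> : (fun x : R => - K * x) = (- K) \*: id by apply/funext.
    by apply: is_derive_eq; rewrite /GRing.scale/= mulr1.
  have de : is_derive z (1 : R) (expR \o (fun x => - K * x)) (expR (- K * z) * - K).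
    exact: is_derive1_comp.
  have dp : is_derive z (1 : R) p (q z) by exact: is_derive_eq.
  have dq : is_derive z (1 : R) q (- g (u z) - - g (v z)) by exact: is_derive_eq.
  rewrite /E; apply: is_derive_eq; rewrite /dE /GRing.scale/=.
  have -> : (p * p + q * q) z = p z * p z + q z * q z by [].
  ring.
have L0 : 0 <= L.
  by have := le_trans (normr_ge0 _) (lip 1 0); rewrite subr0 normr1 mulr1.
have dE0 z : dE z <= 0.
  rewrite /dE; apply: mulr_le0_ge0; last exact: expR_ge0.
  have := lip (u z) (v z); rewrite -[u z - v z]/(p z); set G := g _ - g _ => hG.
  have h1 : - (2 * q z * G) <= 2 * `|q z| * (L * `|p z|).
    rewrite -mulNr; apply: le_trans (ler_norm _) _.
    by rewrite !normrM normrN normrM ger0_norm// ler_wpM2l.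
  have h2 : 2 * `|q z| * (L * `|p z|) <= L * (p z ^+ 2 + q z ^+ 2).
    rewrite -(real_normK (num_real (p z))) -(real_normK (num_real (q z))).
    have := mulr_ge0 L0 (sqr_ge0 (`|p z| - `|q z|)); lra.
  have h3 := sqr_ge0 (p z - q z).
  rewrite /K; lra.
have cE : {within `[a, b], continuous E}.
  have ce : continuous (expR \o (fun x : R => - K * x)).
    move=> z; apply: continuous_comp; last exact: continuous_expR.
    by apply: cvgM; [exact: cvg_cst|exact: cvg_id].
  have ce' := continuous_subspaceT (A := `[a, b]) ce.
  have cp : {within `[a, b], continuous p} by move=> z; apply: cvgB; [exact: cu|exact: cv].
  have cq : {within `[a, b], continuous q} by move=> z; apply: cvgB; [exact: cu1|exact: cv1].
  move=> z; apply: cvgM; last exact: ce'.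
  by apply: cvgD; apply: cvgM; do ?[exact: cp|exact: cq].
have Ex : E x <= E a.
  have /andP[ax xb] : a <= x <= b by rewrite in_itv/= in xab.
  apply: (ler0_derive1_nincr (a := a) (b := b)) => //.
  - by move=> z /derE[].
  - by move=> z /derE dz; rewrite derive1E; case: dz => _ ->; exact: dE0.
have Ea : E a = 0 by rewrite /E /p /q /= !fctE ua u1a !subrr !mul0r addr0 mul0r.
have : p x ^+ 2 + q x ^+ 2 <= 0.
  rewrite -(pmulr_lle0 _ (expR_gt0 (- K * x))) !expr2.
  by rewrite Ea in Ex.
rewrite /p /q /= !fctE => h.
have := sqr_ge0 (u x - v x); have := sqr_ge0 (u1 x - v1 x) => h1 h0.
split; apply/eqP; rewrite -subr_eq0 -sqrf_eq0; apply/eqP; lra.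
Qed.

End Uniqueness.

(** * Explicit arches of solutions *)

Section Arcs.
Context {R : realType}.
Implicit Types (a b c s x : R).

Definition fucik_rhs (alpha beta t : R) : R :=
  alpha * Num.max t 0 - beta * Num.max (- t) 0.

Lemma fucik_rhs_ge0 alpha beta t : 0 <= t -> fucik_rhs alpha beta t = alpha * t.
Proof.
move=> t0; rewrite /fucik_rhs (max_idPl t0) (max_idPr _) ?oppr_le0//.
by rewrite mulr0 subr0.
Qed.

Lemma fucik_rhs_le0 alpha beta t : t <= 0 -> fucik_rhs alpha beta t = beta * t.
Proof.
move=> t0; rewrite /fucik_rhs (max_idPr t0) (max_idPl _) ?oppr_ge0//.
by rewrite mulr0 sub0r mulrN opprK.
Qed.

Lemma fucik_rhs_lipschitz alpha beta : 0 <= alpha -> 0 <= beta -> forall s t,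
  `|fucik_rhs alpha beta s - fucik_rhs alpha beta t| <= (alpha + beta) * `|s - t|.
Proof.
move=> a0 b0 s t; have maxL (x y : R) : `|Num.max x 0 - Num.max y 0| <= `|x - y|.
  have := ler_norm (x - y); have := ler_norm (- (x - y)); rewrite normrN ler_norml.
  by case: (leP x 0) => x0; case: (leP y 0) => y0 h1 h2; apply/andP; split; lra.
have -> : fucik_rhs alpha beta s - fucik_rhs alpha beta t =
  alpha * (Num.max s 0 - Num.max t 0) - beta * (Num.max (- s) 0 - Num.max (- t) 0).
  by rewrite /fucik_rhs; ring.
rewrite mulrDl; apply: le_trans (ler_normB _ _) _; rewrite !normrM (ger0_norm a0) (ger0_norm b0).
apply: lerD; rewrite ler_wpM2l//.
by have := maxL (- s) (- t); rewrite -opprD normrN.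
Qed.

Lemma sin_ge0_arc a c x : 0 < a -> x \in `[c, c + pi / a] -> 0 <= sin (a * (x - c)).
Proof.
move=> a0; rewrite in_itv/= => /andP[cx xc]; apply: sin_ge0_pi; apply/andP; split.
  by rewrite mulr_ge0 ?(ltW a0)// subr_ge0.
by rewrite mulrC -ler_pdivlMr// lerBlDl.
Qed.

Lemma sin_arc_ode (g : R -> R) a c d k :
  (forall x, x \in `[c, d] -> g (k * sin (a * (x - c))) = a ^+ 2 * (k * sin (a * (x - c)))) ->
  ode2_on g c d (fun x => k * sin (a * (x - c))) (fun x => k * a * cos (a * (x - c))).
Proof.
move=> gE; split.
- by apply: continuous_subspaceT => x; apply: cvgM; [exact: cvg_cst|exact: continuous_sin_affine].
- by apply: continuous_subspaceT => x; apply: cvgM; [exact: cvg_cst|exact: continuous_cos_affine].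
move=> x xcd; have ds := is_derive_sin_affine a c x; have dc := is_derive_cos_affine a c x.
split.
  have -> : (fun x => k * sin (a * (x - c))) = k \*: (fun x => sin (a * (x - c))) by [].
  by apply: is_derive_eq; rewrite /GRing.scale/= mulrA.
have -> : (fun x => k * a * cos (a * (x - c))) = (k * a) \*: (fun x => cos (a * (x - c))) by [].
apply: is_derive_eq; rewrite gE; first by rewrite /GRing.scale/=; ring.
by apply: subset_itv xcd; rewrite bnd_simp.
Qed.

(** Over a width [pi / a] the sine arch stays nonnegative, so it solves the equation with right-hand
    side [a^2 u]; uniqueness identifies it with [u]. *)
Lemma positive_arc (alpha beta a c s d : R) (u u1 : R -> R) :
  0 < a -> alpha = a ^+ 2 -> 0 <= beta -> 0 <= s -> c + pi / a <= d ->
  ode2_on (fucik_rhs alpha beta) c d u u1 -> u c = 0 -> u1 c = s ->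
  forall x, x \in `[c, c + pi / a] ->
    u x = s / a * sin (a * (x - c)) /\ u1 x = s * cos (a * (x - c)).
Proof.
move=> a0 -> b0 s0 cd ou uc u1c x xc.
have arc : ode2_on (fucik_rhs (a ^+ 2) beta) c (c + pi / a)
    (fun x => s / a * sin (a * (x - c))) (fun x => s / a * a * cos (a * (x - c))).
  apply: sin_arc_ode => z zc; apply: fucik_rhs_ge0.
  by rewrite mulr_ge0 ?divr_ge0 ?(ltW a0)// sin_ge0_arc.
rewrite divfK ?gt_eqF// in arc.
apply: (ode2_unique (fucik_rhs_lipschitz (sqr_ge0 a) b0) (ode2_on_sub (lexx _) cd ou) arc _ _ xc).
- by rewrite subrr mulr0 sin0 mulr0.
- by rewrite subrr mulr0 cos0 mulr1.
Qed.

Lemma negative_arc (alpha beta b c s d : R) (u u1 : R -> R) :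
  0 < b -> beta = b ^+ 2 -> 0 <= alpha -> 0 <= s -> c + pi / b <= d ->
  ode2_on (fucik_rhs alpha beta) c d u u1 -> u c = 0 -> u1 c = - s ->
  forall x, x \in `[c, c + pi / b] ->
    u x = - (s / b) * sin (b * (x - c)) /\ u1 x = - s * cos (b * (x - c)).
Proof.
move=> b0 -> a0 s0 cd ou uc u1c x xc.
have arc : ode2_on (fucik_rhs alpha (b ^+ 2)) c (c + pi / b)
    (fun x => - (s / b) * sin (b * (x - c))) (fun x => - (s / b) * b * cos (b * (x - c))).
  apply: sin_arc_ode => z zc; apply: fucik_rhs_le0.
  by rewrite mulNr oppr_le0 mulr_ge0 ?divr_ge0 ?(ltW b0)// sin_ge0_arc.
rewrite mulNr divfK ?gt_eqF// in arc.
apply: (ode2_unique (fucik_rhs_lipschitz a0 (sqr_ge0 b)) (ode2_on_sub (lexx _) cd ou) arc _ _ xc).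
- by rewrite subrr mulr0 sin0 mulr0.
- by rewrite subrr mulr0 cos0 mulr1.
Qed.

Lemma fucik_solution_ode (alpha beta : R) (u u1 u2 : R -> R) :
  fucik_solution alpha beta u u1 u2 -> ode2_on (fucik_rhs alpha beta) 0 pi u u1.
Proof.
move=> [[cu cu1 cu2 du] eq _]; split=> // x xI; have [d0 d1] := du x xI; split => //.
apply: is_derive_eq; have := eq x xI; rewrite /funrpos/= /funrneg/= /fucik_rhs => <-.
by rewrite opprK.
Qed.

(* One period consists of a positive arch of width [pi / a] followed by a
   negative one of width [pi / b], both starting with slope of modulus [s]. *)
Lemma fucik_periods (a b s : R) (p : nat) (u u1 : R -> R) (l := pi / a + pi / b) :
  0 < a -> 0 < b -> 0 <= s -> p%:R * l = pi ->
  ode2_on (fucik_rhs (a ^+ 2) (b ^+ 2)) 0 pi u u1 -> u 0 = 0 -> u1 0 = s ->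
  forall k, (k < p)%N ->
    (forall y, y \in `[0, pi / a] -> u (k%:R * l + y) = s / a * sin (a * y)) /\
    (forall y, y \in `[0, pi / b] -> u (k%:R * l + pi / a + y) = - (s / b) * sin (b * y)).
Proof.
move=> a0 b0 s0 pl ou u00 u10.
have la : 0 < pi / a by rewrite divr_gt0// pi_gt0.
have lb : 0 < pi / b by rewrite divr_gt0// pi_gt0.
have l0 : 0 < l by rewrite addr_gt0.
have bound k : (k < p)%N -> k%:R * l + pi / a + pi / b <= pi.
  move=> kp; have -> : k%:R * l + pi / a + pi / b = k.+1%:R * l by rewrite -natr1 /l; ring.
  by rewrite -[leRHS]pl ler_pM2r// ler_nat.
have kl0 k : 0 <= k%:R * l by rewrite mulr_ge0// ltW.
have pos k : (k < p)%N -> u (k%:R * l) = 0 -> u1 (k%:R * l) = s ->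
    forall x, x \in `[k%:R * l, k%:R * l + pi / a] ->
    u x = s / a * sin (a * (x - k%:R * l)) /\ u1 x = s * cos (a * (x - k%:R * l)).
  move=> kp uk u1k; apply: (positive_arc a0 erefl (sqr_ge0 b) s0 (lexx _) _ uk u1k).
  apply: ode2_on_sub ou => //; apply: le_trans (bound k kp); rewrite lerDl ltW//.
have neg k : (k < p)%N -> u (k%:R * l) = 0 -> u1 (k%:R * l) = s ->
    forall x, x \in `[k%:R * l + pi / a, k%:R * l + pi / a + pi / b] ->
    u x = - (s / b) * sin (b * (x - (k%:R * l + pi / a))) /\
    u1 x = - s * cos (b * (x - (k%:R * l + pi / a))).
  move=> kp uk u1k.
  have end_in : k%:R * l + pi / a \in `[k%:R * l, k%:R * l + pi / a].
    by rewrite in_itv/= lexx andbT lerDl ltW.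
  have [ue u1e] := pos k kp uk u1k _ end_in.
  have E : a * (k%:R * l + pi / a - k%:R * l) = pi by rewrite addrAC subrr add0r mulrC divfK ?gt_eqF.
  rewrite E sinpi mulr0 in ue; rewrite E cospi mulrN1 in u1e.
  apply: (negative_arc b0 erefl (sqr_ge0 a) s0 (lexx _) _ ue u1e).
  by apply: ode2_on_sub ou; [rewrite addr_ge0// ltW|exact: bound].
(* Each arch reverses the slope, so after a full period the initial data [0] and [s] recur. *)
have start k : (k <= p)%N -> u (k%:R * l) = 0 /\ u1 (k%:R * l) = s.
  elim: k => [_|k IH kp]; first by rewrite mul0r.
  have [uk u1k] := IH (ltnW kp).
  have end_in : k.+1%:R * l \in `[k%:R * l + pi / a, k%:R * l + pi / a + pi / b].
    by rewrite -natr1 mulrDl mul1r /l in_itv/= addrA lexx andbT lerDl ltW.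
  have [-> ->] := neg k kp uk u1k _ end_in.
  have -> : b * (k.+1%:R * l - (k%:R * l + pi / a)) = pi.
    rewrite -natr1 mulrDl mul1r addrAC -addrA; rewrite /l.
    have -> : k%:R * (pi / a + pi / b) +
      (- (k%:R * (pi / a + pi / b) + pi / a) + (pi / a + pi / b)) = pi / b by ring.
    by rewrite mulrC divfK ?gt_eqF.
  by rewrite sinpi cospi mulr0 mulrN1 opprK.
move=> k kp; have [uk u1k] := start k (ltnW kp); split => y yI.
  have yI' : k%:R * l + y \in `[k%:R * l, k%:R * l + pi / a].
    by move: yI; rewrite !in_itv/= lerDl lerD2l.
  have [-> _] := pos k kp uk u1k _ yI'.
  by rewrite [X in X - _]addrC addrK.
have yI' : k%:R * l + pi / a + y \in `[k%:R * l + pi / a, k%:R * l + pi / a + pi / b].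
  by move: yI; rewrite !in_itv/= lerDl lerD2l.
have [-> _] := neg k kp uk u1k _ yI'.
by rewrite [X in X - _]addrC addrK.
Qed.

End Arcs.

(** * Shape of the eigenfunctions and their distance to the sines *)

Section Profile.
Context {R : realType}.
Implicit Types (a b s x : R).

Lemma sup_eq (S : set R) m : S m -> (forall x, S x -> x <= m) -> sup S = m.
Proof.
move=> Sm mS; apply/eqP; rewrite eq_le; apply/andP; split.
  by apply: ge_sup; [exists m|move=> x /mS].
by apply: ub_le_sup => //; exists m => x /mS.
Qed.

Lemma sin_lipschitz x y : `|sin x - sin y| <= `|x - y| :> R.
Proof.
wlog yx : x y / y < x.
  move=> h; have [xy|yx|->] := ltgtP x y; last by rewrite !subrr.
    by rewrite distrC [leRHS]distrC; exact: h.
  exact: h.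
have [|c _ ->] := @MVT R sin cos y x yx (fun z _ => is_derive_sin z).
  exact/continuous_subspaceT/continuous_sin.
by rewrite normrM -[leRHS]mul1r ler_wpM2r// ler_norml cos_geN1 cos_le1.
Qed.

Lemma sinD2pin x k : sin (x + k%:R * (2 * pi)) = sin x :> R.
Proof.
elim: k => [|k IH]; first by rewrite mul0r addr0.
rewrite -natr1 mulrDl mul1r addrA -[RHS]IH mulr2n mulrDl mul1r addrA.
by rewrite !sinDpi opprK.
Qed.

Lemma cosD2pin x k : cos (x + k%:R * (2 * pi)) = cos x :> R.
Proof.
elim: k => [|k IH]; first by rewrite mul0r addr0.
rewrite -natr1 mulrDl mul1r addrA -[RHS]IH mulr2n mulrDl mul1r addrA.
by rewrite !cosDpi opprK.
Qed.

(** The constraint makes [n] the harmonic mean of [a] and [b], so [n] lies between them and both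
    relative errors are controlled by the excess of the larger one over [n]. *)
Lemma amplitude_estimates a b n : 0 < a -> 0 < b -> 0 < n -> n / a + n / b = 2 ->
  [/\ 1 - Num.min a b / a <= 2 * (Num.max a b - n) / n,
      `|a - n| / a <= (Num.max a b - n) / n & Num.min a b / a <= 1].
Proof.
move=> a0 b0 n0 E.
have {E}E : n * (a + b) = 2 * (a * b).
  by rewrite -E; field; rewrite !gt_eqF.
have [ab|/ltW ba] := leP a b.
  have an : a <= n by nra.
  have nb : n <= b by nra.
  rewrite divff ?gt_eqF// subrr lexx; split=> //.
    by rewrite divr_ge0 ?(ltW n0)// mulr_ge0// subr_ge0.
  rewrite ler0_norm ?subr_le0// opprB ler_pdivrMr// mulrAC ler_pdivlMr//; nra.
have na : n <= a by nra.
have bn : b <= n by nra.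
split; last by rewrite ler_pdivrMr// mul1r.
  rewrite -[X in X - _](divff (lt0r_neq0 a0)) -mulrBl ler_pdivrMr// mulrAC ler_pdivlMr//; nra.
rewrite ger0_norm ?subr_ge0// ler_pdivrMr// mulrAC ler_pdivlMr//; nra.
Qed.

(** The amplitude defect contributes the 2. The frequency defect contributes the [pi], because
    [|a - n| * |y|] is at most [pi * |a - n| / a] on an arch. *)
Lemma arc_estimate a b n y : 0 < a -> 0 < b -> 0 < n -> n / a + n / b = 2 ->
  `|y| <= pi / a ->
  `|Num.min a b / a * sin (a * y) - sin (n * y)| <= (2 + pi) * ((Num.max a b - n) / n).
Proof.
move=> a0 b0 n0 E yl; have [e1 e2 e3] := amplitude_estimates a0 b0 n0 E.
set A := Num.min a b / a in e1 e3 *; set T := (Num.max a b - n) / n in e2 *.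
have -> : A * sin (a * y) - sin (n * y) =
   (A - 1) * sin (a * y) + (sin (a * y) - sin (n * y)) by ring.
rewrite [leRHS]mulrDl; apply: le_trans (ler_normD _ _) _; apply: lerD.
  rewrite normrM ler0_norm ?subr_le0// opprB -[leRHS]mulr1 ler_pM//.
  - by rewrite subr_ge0.
  - by rewrite /T mulrA.
  - by rewrite ler_norml sin_geN1 sin_le1.
apply: le_trans (sin_lipschitz _ _) _; rewrite -mulrBl normrM.
apply: le_trans (ler_wpM2l (normr_ge0 _) yl) _.
by rewrite mulrCA ler_wpM2l// pi_ge0.
Qed.

Lemma in_some_period (l x : R) k : 0 <= l -> 0 <= x -> x <= k.+1%:R * l ->
  exists2 j, (j < k.+1)%N & exists2 y, 0 <= y <= l & x = j%:R * l + y.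
Proof.
move=> l0 x0; elim: k => [xl|k IH xl].
  by exists 0%N => //; exists x; rewrite ?x0 ?mul0r ?add0r// -[leRHS]mul1r.
have [/IH[j jk [y yl ->]]|kx] := leP x (k.+1%:R * l).
  by exists j; [exact: ltnW|exists y].
exists k.+1 => //; exists (x - k.+1%:R * l); last by rewrite addrC subrK.
by rewrite subr_ge0 ltW//= lerBlDl -[leRHS]addrC -[X in X + _]mul1r -mulrDl nat1r.
Qed.

(** The slope [s] at the zeros encodes the normalization: the arch heights are [s / a] and [s / b],
    and the choice of the minimum makes the larger one 1. *)
Definition even_profile (a b : R) (p : nat) (u : R -> R) : Prop :=
  let l := pi / a + pi / b in let s := Num.min a b in
  [/\ 0 < a, 0 < b, p%:R * l = pi, {within `[0, pi], continuous u} &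
    forall k, (k < p)%N ->
    (forall y, y \in `[0, pi / a] -> u (k%:R * l + y) = s / a * sin (a * y)) /\
    (forall y, y \in `[0, pi / b] ->
       u (k%:R * l + pi / a + y) = - (s / b) * sin (b * y))].

Lemma even_profileP n (alpha beta : R) (u : R -> R) : (0 < n)%N -> ~~ odd n ->
  fucik_curve n (alpha, beta) -> normalized_fucik_eigenfunction n alpha beta u ->
  even_profile (Num.sqrt alpha) (Num.sqrt beta) n./2 u.
Proof.
move=> n0 on [/= alpha0 beta0]; rewrite (negPf on) => curve.
rewrite /normalized_fucik_eigenfunction; case: eqP on => [->//|_ on].
move=> [u1 [u2 [sol s0 sup1]]].
set a := Num.sqrt alpha; set b := Num.sqrt beta; set s := u1 0 in s0.
have a0 : 0 < a by rewrite sqrtr_gt0.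
have b0 : 0 < b by rewrite sqrtr_gt0.
set l := pi / a + pi / b.
have pl : n./2%:R * l = pi.
  rewrite -[RHS]curve -mulrDr; congr (_ * _).
  by rewrite -[in RHS](odd_double_half n) (negPf on) add0n -muln2 natrM mulfK.
have p0 : (0 < n./2)%N by move: n0 on; case: (n) => [|[|?]].
have ou := fucik_solution_ode sol; have [[cu _ _ _] _ [u00 upi]] := sol.
rewrite -(sqr_sqrtr (ltW alpha0)) -(sqr_sqrtr (ltW beta0)) in ou.
have per := fucik_periods a0 b0 (ltW s0) pl ou u00 erefl.
have la : 0 < pi / a by rewrite divr_gt0// pi_gt0.
have lb : 0 < pi / b by rewrite divr_gt0// pi_gt0.
have l0 : 0 < l by rewrite addr_gt0.
have lpi : l <= pi by rewrite -[leRHS]pl (ler_peMl (ltW l0))// ler1n.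
(* The supremum is attained at the midpoint of one of the first two arches, so it is the larger of
   [s / a] and [s / b]; being 1, it determines [s]. *)
have sE : s = Num.min a b.
  have sinpa (c : R) : 0 < c -> sin (c * (pi / c / 2)) = 1.
    by move=> c0; rewrite mulrA mulrCA divff ?gt_eqF// mulr1 sin_pihalf.
  have sin1 (x : R) : `|sin x| <= 1 by rewrite ler_norml sin_geN1 sin_le1.
  have [pa pb] := per 0%N p0.
  have ha : pi / a / 2 \in `[0, pi / a] by rewrite in_itv/=; apply/andP; split; lra.
  have hb : pi / b / 2 \in `[0, pi / b] by rewrite in_itv/=; apply/andP; split; lra.
  have ua := pa _ ha; rewrite sinpa// mulr1 mul0r add0r in ua.
  have ub := pb _ hb; rewrite sinpa// mulr1 mul0r add0r in ub.
  have sa0 : 0 < s / a by rewrite divr_gt0.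
  have sb0 : 0 < s / b by rewrite divr_gt0.
  have supE : sup [set `|u x| | x in `[0, pi]] = Num.max (s / a) (s / b).
    apply: sup_eq.
      have [ab|ba] := leP (s / a) (s / b).
        exists (pi / a + pi / b / 2); last by rewrite ub normrN gtr0_norm.
        by rewrite /= in_itv/=; apply/andP; split; [|apply: le_trans lpi]; rewrite /l; lra.
      exists (pi / a / 2); last by rewrite ua gtr0_norm.
      by rewrite /= in_itv/=; apply/andP; split; [|apply: le_trans lpi]; rewrite /l; lra.
    move=> _ [x /= + <-]; rewrite in_itv/= => /andP[x0 xpi].
    rewrite -[leRHS]pl -(prednK p0) in xpi.
    have [k kp [y /andP[y0 yl] ->]] := in_some_period (ltW l0) x0 xpi.
    rewrite prednK// in kp; have [ka kb] := per k kp.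
    have [ya|/ltW ya] := leP y (pi / a).
      rewrite ka ?in_itv/= ?y0// normrM gtr0_norm// le_max; apply/orP; left.
      by rewrite ler_piMr// ltW.
    have yb : y - pi / a \in `[0, pi / b].
      by rewrite in_itv/= subr_ge0 ya/= lerBlDl.
    have -> : k%:R * l + y = k%:R * l + pi / a + (y - pi / a) by ring.
    rewrite kb// normrM normrN (gtr0_norm sb0) le_max; apply/orP; right.
    by rewrite ler_piMr// ltW.
  rewrite supE in sup1; move: sup1.
  have [ab|ba] := leP (s / a) (s / b) => sup1.
    have sb : s = b by rewrite -[RHS]mul1r -sup1 divfK ?gt_eqF.
    by rewrite sb min_r//; move: ab; rewrite sb divff ?gt_eqF// ler_pdivrMr// mul1r.
  have sa : s = a by rewrite -[RHS]mul1r -sup1 divfK ?gt_eqF.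
  by rewrite sa min_l//; move: ba; rewrite sa divff ?gt_eqF// ltr_pdivrMr// mul1r => /ltW.
by split => //; rewrite -sE.
Qed.

(** For equal parameters the equation is linear with solution [s / n * sin (n x)]; the supremum,
    attained at [pi / (2 n)], forces [s = n]. *)
Lemma odd_profile n (u : R -> R) : (0 < n)%N ->
  normalized_fucik_eigenfunction n (n%:R ^+ 2) (n%:R ^+ 2) u ->
  forall x, x \in `[0, pi] -> u x = sin (n%:R * x).
Proof.
move=> n0; rewrite /normalized_fucik_eigenfunction; case: eqP => [->|_].
  by move=> h x xI; rewrite mul1r; exact: h.
move=> [u1 [u2 [sol s0 sup1]]] x xI; set s := u1 0 in s0.
have ou := fucik_solution_ode sol; have [_ _ [u00 upi]] := sol.
have N0 : 0 < n%:R :> R by rewrite ltr0n.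
have arc : ode2_on (fucik_rhs (n%:R ^+ 2) (n%:R ^+ 2)) 0 pi
    (fun x => s / n%:R * sin (n%:R * (x - 0))) (fun x => s / n%:R * n%:R * cos (n%:R * (x - 0))).
  apply: sin_arc_ode => z zc; have [h|/ltW h] := leP 0 (s / n%:R * sin (n%:R * (z - 0))).
    by rewrite fucik_rhs_ge0.
  by rewrite fucik_rhs_le0.
have lip := fucik_rhs_lipschitz (sqr_ge0 (n%:R : R)) (sqr_ge0 (n%:R : R)).
have uE z : z \in `[0, pi] -> u z = s / n%:R * sin (n%:R * z).
  move=> zI; have [||+ _] := ode2_unique lip ou arc _ _ zI.
  - by rewrite subrr mulr0 sin0 mulr0.
  - by rewrite subrr mulr0 cos0 mulr1 divfK ?gt_eqF.
  - by rewrite subr0.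
have sn0 : 0 < s / n%:R by rewrite divr_gt0.
suff sn : s / n%:R = 1 by rewrite uE// sn mul1r.
rewrite -[RHS]sup1; apply/esym/sup_eq.
  have n1 : 1 <= n%:R :> R by rewrite ler1n.
  have hI : pi / 2 / n%:R \in `[0, pi : R].
    have pi0 := pi_gt0 R; rewrite in_itv/= !divr_ge0 ?pi_ge0//= ler_pdivrMr//.
    by apply: le_trans (ler_peMr (pi_ge0 R) n1); lra.
  exists (pi / 2 / n%:R); first exact: hI.
  have -> : u (pi / 2 / n%:R) = s / n%:R * sin (n%:R * (pi / 2 / n%:R)) by exact: uE.
  have -> : n%:R * (pi / 2 / n%:R) = pi / 2 :> R by rewrite mulrC divfK ?gt_eqF.
  by rewrite sin_pihalf mulr1 gtr0_norm.
move=> _ [z /= zI <-]; rewrite uE// normrM gtr0_norm// ler_piMr ?(ltW sn0)//.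
by rewrite ler_norml sin_geN1 sin_le1.
Qed.

(** Since [n * l = 2 pi], the sine has the same period [l] as the profile, so a single period
    suffices. *)
Lemma even_profile_near (a b : R) n (u : R -> R) : (0 < n)%N -> ~~ odd n ->
  even_profile a b n./2 u -> forall x, x \in `[0, pi] ->
  `|u x - sin (n%:R * x)| <= (2 + pi) * ((Num.max a b - n%:R) / n%:R).
Proof.
move=> n0 on [a0 b0]; set l := pi / a + pi / b => pl _ per x.
rewrite in_itv/= => /andP[x0 xpi].
have p0 : (0 < n./2)%N by move: n0 on; case: (n) => [|[|?]].
have N0 : 0 < n%:R :> R by rewrite ltr0n.
have nE : n%:R = n./2%:R * 2 :> R.
  by rewrite -[in LHS](odd_double_half n) (negPf on) add0n -muln2 natrM.
have nl : n%:R * l = 2 * pi by rewrite nE mulrAC pl mulrC.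
have l0 : 0 < l by rewrite addr_gt0// divr_gt0// pi_gt0.
have E : n%:R / a + n%:R / b = 2.
  apply: (mulIf (lt0r_neq0 (pi_gt0 R))); rewrite -nl /l; ring.
rewrite -[leRHS]pl -(prednK p0) in xpi.
have [k kp [y /andP[y0 yl] ->]] := in_some_period (ltW l0) x0 xpi.
rewrite prednK// in kp; have [ka kb] := per k kp.
have sk z : sin (n%:R * (k%:R * l + z)) = sin (n%:R * z).
  by rewrite mulrDr mulrCA nl addrC sinD2pin.
have [ya|/ltW ya] := leP y (pi / a).
  rewrite ka ?in_itv/= ?y0// sk; apply: arc_estimate => //.
  by rewrite ger0_norm.
have yb : y - pi / a \in `[0, pi / b].
  by rewrite in_itv/= subr_ge0 ya/= lerBlDl.
rewrite sk; have -> : k%:R * l + y = k%:R * l + pi / a + (y - pi / a) by ring.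
rewrite kb//.
(* Seen from the right end [l] of the period, the negative arch is a positive one with [a] and [b]
   exchanged, at distance at most [pi / b]. *)
have -> : - (Num.min a b / b) * sin (b * (y - pi / a)) =
    Num.min b a / b * sin (b * (y - l)).
  have -> : b * (y - pi / a) = b * (y - l) + pi.
    by rewrite /l; field; rewrite !gt_eqF.
  by rewrite sinDpi minC; ring.
have -> : sin (n%:R * y) = sin (n%:R * (y - l)).
  by rewrite -[RHS](sinD2pin _ 1) mul1r -nl -mulrDr subrK.
rewrite maxC; apply: arc_estimate => //; first by rewrite addrC.
rewrite ler0_norm ?subr_le0// opprB /l; lra.
Qed.

End Profile.

(** * Fourier coefficients of periodic profiles *)

Section Integrals.
Context {R : realType}.
Local Notation mu := (@lebesgue_measure R).

Lemma Rintegral_shift (f : R -> R) (a b c : R) : a <= b ->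
  {within `[a + c, b + c], continuous f} ->
  \int[mu]_(x in `[a + c, b + c]) f x = \int[mu]_(x in `[a, b]) f (x + c).
Proof.
move=> ab cf; rewrite /Rintegral; congr fine.
have dF x : is_derive x (1 : R) (+%R^~ c) 1.
  have -> : (+%R^~ c) = (id + cst c : R -> R) by apply/funext.
  by apply: is_derive_eq; rewrite addr0.
have cF : continuous (+%R^~ c : R -> R).
  by move=> x; apply: differentiable_continuous; apply/derivable1_diffP; case: (dF x).
have F'E : derive1 (+%R^~ c : R -> R) = cst 1.
  by apply/funext => x; rewrite derive1E; case: (dF x).
rewrite (@integration_by_substitution_increasing _ (+%R^~ c) f a b ab)//.
- by apply: eq_integral => x _; rewrite F'E /= mulr1.
- by move=> x y _ _ xy; rewrite ltrD2r.
- by move=> x _; rewrite F'E; exact: cvg_cst.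
- by rewrite F'E; exact: is_cvg_cst.
- by rewrite F'E; exact: is_cvg_cst.
- split.
  + by move=> x _; case: (dF x).
  + exact: cvg_at_right_filter (cF _).
  + exact: cvg_at_left_filter (cF _).
Qed.

Lemma Rintegral_chasles (f : R -> R) (a b c : R) : a <= b -> b <= c ->
  {within `[a, c], continuous f} ->
  \int[mu]_(x in `[a, c]) f x = \int[mu]_(x in `[a, b]) f x + \int[mu]_(x in `[b, c]) f x.
Proof.
move=> ab bc cf; have fi := continuous_integrable cf.
have := Rintegral_itvB (x := b) fi.
rewrite !bnd_simp => /(_ ab bc); rewrite Rintegral_itv_obnd_cbnd; last first.
  by apply: integrableS fi => //; apply: subset_itv; rewrite bnd_simp.
by move=> <-; rewrite addrC subrK.
Qed.

Lemma Rintegral_periods (f : R -> R) (l : R) (p : nat) : 0 <= l ->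
  {within `[0, p%:R * l], continuous f} ->
  \int[mu]_(x in `[0, p%:R * l]) f x =
  \sum_(k < p) \int[mu]_(y in `[0, l]) f (k%:R * l + y).
Proof.
move=> l0; elim: p => [_|p IH cf].
  by rewrite big_ord0 mul0r set_itv1 Rintegral_set1.
have pl : 0 <= p%:R * l by rewrite mulr_ge0.
have pl' : p%:R * l <= p.+1%:R * l by rewrite ler_wpM2r// ler_nat.
rewrite (Rintegral_chasles pl pl' cf) big_ord_recr/= IH; last first.
  by apply: continuous_subspaceW cf; apply: subset_itv; rewrite bnd_simp.
congr (_ + _); have e : p.+1%:R * l = l + p%:R * l by rewrite -natr1 mulrDl mul1r addrC.
rewrite -[X in `[X, _]]add0r e Rintegral_shift//.
  by apply: eq_Rintegral => x _; rewrite addrC.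
apply: continuous_subspaceW cf; rewrite add0r e.
by apply: subset_itv; rewrite bnd_simp.
Qed.

(** Telescoping of [2 sin h sin A = cos (A - h) - cos (A + h)] with [h = m l / 2], as for the
    Dirichlet kernel. *)
Lemma sum_sin_shift (m l x : R) (p : nat) :
  2 * sin (m * l / 2) * \sum_(k < p) sin (m * (k%:R * l + x)) =
  cos (m * x - m * l / 2) - cos (m * x + p%:R * (m * l) - m * l / 2).
Proof.
elim: p => [|p IH]; first by rewrite big_ord0 mulr0 mul0r addr0 subrr.
rewrite big_ord_recr/= mulrDr IH -[p.+1%:R]natr1.
have -> : m * (p%:R * l + x) = m * x + p%:R * (m * l) by ring.
have -> : m * x + (p%:R + 1) * (m * l) - m * l / 2 =
  m * x + p%:R * (m * l) + m * l / 2 by field.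
set A := m * x + p%:R * (m * l); set h := m * l / 2.
by rewrite (cosB A) (cosD A); ring.
Qed.

Lemma sin_eq0_natpi x : 0 < x -> sin x = 0 -> exists k : nat, x = k%:R * pi :> R.
Proof.
move=> x0 sx; pose k := Num.truncn (x / pi).
have xp0 : 0 <= x / pi by rewrite divr_ge0 ?pi_ge0 ?ltW.
have /andP[kx xk] := truncn_itv xp0.
rewrite -/k ler_pdivlMr ?pi_gt0// in kx; rewrite -/k ltr_pdivrMr ?pi_gt0// in xk.
have [y0|y0] := eqVneq (x - k%:R * pi) 0; first by exists k; apply/eqP; rewrite -subr_eq0 y0.
have : 0 < sin (x - k%:R * pi).
  apply: sin_gt0_pi; rewrite lt_neqAle eq_sym y0 subr_ge0 kx/= ltrBlDl.
  by rewrite -[k.+1%:R]natr1 mulrDl mul1r in xk.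
by rewrite sinB sx sin_natpi mul0r mulr0 subr0 ltxx.
Qed.

(** For [a != n], the Wronskian identity reads [(a^2 - n^2) J = a sin (n pi / a)]. Both [a^2 - n^2]
    and the sine are positive for [n < a] and negative for [a < n < 2 a]. *)
Lemma Rintegral_sin_sin_gt0 (a n : R) : 0 < a -> 0 < n -> n / a < 2 ->
  0 < \int[mu]_(x in `[0, pi / a]) (sin (a * x) * sin (n * x)).
Proof.
move=> a0 n0 na; have la : 0 < pi / a by rewrite divr_gt0// pi_gt0.
have ala : a * (pi / a) = pi by rewrite mulrC divfK ?gt_eqF.
have [<-|an] := eqVneq a n.
  rewrite Rintegral_sin_sqr ?gt_eqF// ala sinpi mulr0 sin0 !mul0r !subr0.
  by rewrite divr_gt0.
have := Rintegral_sin_sin a n la.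
rewrite ala sinpi cospi !mulr0 sin0 !mul0r !mulr0 mul0r !subr0 sub0r mulrN1 mulNr opprK.
set J := Rintegral _ _ _ => E.
have aE : (a ^+ 2 - n ^+ 2) = (a - n) * (a + n) by ring.
have an0 : 0 < a + n by rewrite addr_gt0.
have [na'|na'] := ltP n a.
  have s0 : 0 < sin (n * (pi / a)).
    apply: sin_gt0_pi; rewrite mulr_gt0//= mulrA ltr_pdivrMr// mulrC ltr_pM2l ?pi_gt0//.
  have : 0 < (a ^+ 2 - n ^+ 2) * J by rewrite E mulr_gt0.
  by rewrite pmulr_rgt0// aE mulr_gt0// subr_gt0.
have an' : a < n by rewrite lt_neqAle an.
have s0 : sin (n * (pi / a)) < 0.
  rewrite -(subrK pi (n * (pi / a))) sinDpi oppr_lt0; apply: sin_gt0_pi.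
  have nE : n * (pi / a) = n / a * pi by field; rewrite gt_eqF.
  have n1 : 1 < n / a by rewrite ltr_pdivlMr// mul1r.
  have := pi_gt0 R => pi0; rewrite nE; apply/andP; split; nra.
have : (a ^+ 2 - n ^+ 2) * J < 0 by rewrite E pmulr_rlt0.
by rewrite nmulr_rlt0// aE pmulr_llt0// subr_lt0.
Qed.

End Integrals.

(** * Coefficients of an eigenfunction of even index *)

Section Coefficients.
Context {R : realType}.
Local Notation mu := (@lebesgue_measure R).
Variables (a b : R) (n : nat) (u : R -> R).
Hypothesis n0 : (0 < n)%N.
Hypothesis n_even : ~~ odd n.
Hypothesis prof : even_profile a b n./2 u.

Let l := pi / a + pi / b.

Let a0 : 0 < a. Proof. by case: prof. Qed.
Let b0 : 0 < b. Proof. by case: prof. Qed.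
Let pl : n./2%:R * l = pi. Proof. by case: prof. Qed.
Let cu : {within `[0, pi], continuous u}. Proof. by case: prof. Qed.
Let la : 0 < pi / a. Proof. by rewrite divr_gt0// pi_gt0. Qed.
Let lb : 0 < pi / b. Proof. by rewrite divr_gt0// pi_gt0. Qed.
Let l0 : 0 < l. Proof. by rewrite addr_gt0. Qed.
Let p0 : (0 < n./2)%N.
Proof. by move: n0 n_even; case: (n) => [|[|?]]. Qed.
Let nE : n%:R = n./2%:R * 2 :> R.
Proof. by rewrite -[in LHS](odd_double_half n) (negPf n_even) add0n -muln2 natrM. Qed.
Let nl : n%:R * l = 2 * pi. Proof. by rewrite nE mulrAC pl mulrC. Qed.
Let lpi : l <= pi. Proof. by rewrite -[leRHS]pl (ler_peMl (ltW l0))// ler1n. Qed.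

Lemma even_profile_periodic k y : (k < n./2)%N -> y \in `[0, l] ->
  u (k%:R * l + y) = u y.
Proof.
have [_ _ _ _ per] := prof; move=> kp; rewrite in_itv/= => /andP[y0 yl].
have [ka kb] := per k kp; have [za zb] := per 0%N p0.
have [ya|/ltW ya] := leP y (pi / a).
  have yI : y \in `[0, pi / a] by rewrite in_itv/= y0.
  by rewrite ka// -(za _ yI) mul0r add0r.
have yb : y - pi / a \in `[0, pi / b] by rewrite in_itv/= subr_ge0 ya/= lerBlDl.
have -> : k%:R * l + y = k%:R * l + pi / a + (y - pi / a) by ring.
by rewrite kb// -(zb _ yb) mul0r add0r addrC subrK.
Qed.

(** Periodicity folds the integral onto one period, after which only the sines carry the shifts. *)
Lemma Rintegral_even_profile m :
  \int[mu]_(x in `[0, pi]) (u x * sin (m%:R * x)) =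
  \int[mu]_(y in `[0, l]) (u y * \sum_(k < n./2) sin (m%:R * (k%:R * l + y))).
Proof.
have cs (r : R) : continuous (fun x => sin (r * x)) by exact: continuous_sinM.
have cus : {within `[0, pi], continuous (fun x => u x * sin (m%:R * x))}.
  by move=> x; apply: cvgM; [exact: cu|exact: (continuous_subspaceT (cs m%:R))].
rewrite -{1}pl Rintegral_periods ?pl//; last exact: ltW.
have cul : {within `[0, l], continuous u}.
  by apply: continuous_subspaceW cu; apply: subset_itv; rewrite bnd_simp.
have csk k : continuous (fun y : R => sin (m%:R * (k%:R * l + y))).
  have -> : (fun y : R => sin (m%:R * (k%:R * l + y))) = (fun y => sin (m%:R * (y - - (k%:R * l)))).
    by apply/funext => y; rewrite opprK addrC.
  exact: continuous_sin_affine.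
have csum q : continuous (fun y : R => \sum_(k < q) sin (m%:R * (k%:R * l + y))).
  elim: q => [|q IH]; first by under eq_fun do rewrite big_ord0; move=> y; exact: cvg_cst.
  under eq_fun do rewrite big_ord_recr/=.
  by move=> y; apply: cvgD; [exact: IH|exact: csk].
have step q : (q <= n./2)%N ->
    \sum_(k < q) \int[mu]_(y in `[0, l]) (u (k%:R * l + y) * sin (m%:R * (k%:R * l + y))) =
    \int[mu]_(y in `[0, l]) (u y * \sum_(k < q) sin (m%:R * (k%:R * l + y))).
  elim: q => [|q IH] qp.
    rewrite big_ord0; under eq_Rintegral do rewrite big_ord0 mulr0.
    by rewrite Rintegral_cst// mul0r.
  rewrite big_ord_recr/= IH ?(ltnW qp)//.
  under [in RHS]eq_Rintegral do rewrite big_ord_recr/= mulrDr.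
  rewrite RintegralD//; first last.
  - apply: continuous_integrable => x; apply: cvgM; first exact: cul.
    exact: (continuous_subspaceT (csk q)).
  - apply: continuous_integrable => x; apply: cvgM; first exact: cul.
    exact: (continuous_subspaceT (csum q)).
  congr (_ + _); apply: eq_Rintegral => y; rewrite inE => yl.
  by rewrite even_profile_periodic.
exact: step.
Qed.

(* The shifted sines sum to zero over a full rotation. *)
Lemma even_profile_orth m : (0 < m)%N -> ~~ odd m -> ~~ (n %| m)%N ->
  ipL2 u (sine m) = 0.
Proof.
move=> m0 om nm; rewrite /ipL2 Rintegral_oo_cc; last first.
  move=> x; apply: cvgM; first exact: cu.
  by apply: (continuous_subspaceT (@continuous_sinM R m%:R)).
rewrite Rintegral_even_profile.
under eq_Rintegral => y _.
  rewrite (_ : \sum_(k < _) _ = 0); last first.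
    have := @sum_sin_shift R m%:R l y n./2.
    rewrite (mulrCA _ m%:R l) pl.
    (* As [m] is even, the total shift [m pi] is a multiple of [2 pi], so the two cosines of the
       telescoped sum cancel. *)
    have -> : m%:R * y + m%:R * pi - m%:R * l / 2 = (m%:R * y - m%:R * l / 2) + m./2%:R * (2 * pi).
      have -> : m%:R = m./2%:R * 2 :> R.
        by rewrite -[in LHS](odd_double_half m) (negPf om) add0n -muln2 natrM.
      by field.
    rewrite cosD2pin subrr => /eqP; rewrite mulf_eq0 => /orP[|/eqP//].
    rewrite mulf_eq0 pnatr_eq0/= => /eqP.
    (* If [m l / 2 = j pi], multiplying by [n] and using [n l = 2 pi] gives [m = j n], against the
       hypothesis. *)
    move=> /sin_eq0_natpi[|j jE]; first by rewrite !mulr_gt0// ?ltr0n// invr_gt0.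
    exfalso; move/negP : nm; apply; apply/dvdnP; exists j.
    apply/eqP; rewrite -(eqr_nat R) natrM; apply/eqP.
    apply: (mulIf (lt0r_neq0 (pi_gt0 R))).
    have -> : m%:R * pi = n%:R * (m%:R * l / 2) :> R.
      have -> : n%:R * (m%:R * l / 2) = (n%:R * l) * (m%:R / 2) by ring.
      by rewrite nl; field.
    by rewrite jE; ring.
  rewrite mulr0; over.
by rewrite Rintegral_cst// mul0r mulr0.
Qed.

(** For [m = n] all shifted sines coincide, so the coefficient is a positive multiple of the sum of
    two arch integrals. Both are positive because [n / a] and [n / b] are positive with sum 2, hence
    each below 2. *)
Lemma even_profile_diag : ipL2 u (sine n) != 0.
Proof.
rewrite /ipL2 Rintegral_oo_cc; last first.
  move=> x; apply: cvgM; first exact: cu.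
  by apply: (continuous_subspaceT (@continuous_sinM R n%:R)).
rewrite Rintegral_even_profile.
have sk y : \sum_(k < n./2) sin (n%:R * (k%:R * l + y)) = n./2%:R * sin (n%:R * y).
  under eq_bigr => k _ do rewrite mulrDr mulrCA nl addrC sinD2pin.
  by rewrite sumr_const card_ord [RHS]mulr_natl.
under eq_Rintegral do rewrite sk mulrCA.
have cus c d : 0 <= c -> d <= pi ->
    {within `[c, d], continuous (fun x => u x * sin (n%:R * x))}.
  move=> c0 dpi x; apply: cvgM; last exact: (continuous_subspaceT (@continuous_sinM R n%:R)).
  have cu' : {within `[c, d], continuous u}; last exact: cu'.
  by apply: continuous_subspaceW cu; apply: subset_itv; rewrite bnd_simp.
rewrite RintegralZl//; last by apply: continuous_integrable; exact: cus.
have lal : pi / a <= l by rewrite lerDl ltW.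
rewrite (Rintegral_chasles (ltW la) lal (cus _ _ (lexx _) lpi)).
have [_ _ _ _ per] := prof; have [za zb] := per 0%N p0.
set s := Num.min a b in za zb.
have s0 : 0 < s by rewrite lt_min a0.
have E : n%:R / a + n%:R / b = 2.
  by apply: (mulIf (lt0r_neq0 (pi_gt0 R))); rewrite -nl /l; ring.
have N0 : 0 < n%:R :> R by rewrite ltr0n.
have nab (c : R) : 0 < c -> 0 < n%:R / c by move=> c0; rewrite divr_gt0.
have na2 : n%:R / a < 2 by have := nab b b0; lra.
have nb2 : n%:R / b < 2 by have := nab a a0; lra.
have ss (c d e : R) : {within `[d, e], continuous (fun x => sin (c * x) * sin (n%:R * x))}.
  by apply: continuous_subspaceT => x; apply: cvgM; exact: continuous_sinM.
have -> : \int[mu]_(x in `[0, pi / a]) (u x * sin (n%:R * x)) =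
    s / a * \int[mu]_(x in `[0, pi / a]) (sin (a * x) * sin (n%:R * x)).
  rewrite -RintegralZl//; last exact: continuous_integrable.
  apply: eq_Rintegral => x; rewrite inE => /za; rewrite mul0r add0r => ->.
  by rewrite mulrA.
have -> : \int[mu]_(x in `[pi / a, l]) (u x * sin (n%:R * x)) =
    s / b * \int[mu]_(x in `[0, pi / b]) (sin (b * x) * sin (n%:R * x)).
  (* A shift by the period moves the negative arch to [[- pi / b, 0]]; the reflection [x -> - x]
     then preserves the product of sines. *)
  have e1 : pi / a = - (pi / b) + l by rewrite /l; ring.
  have nlb : - (pi / b) <= 0 by rewrite oppr_le0 ltW.
  rewrite -[X in `[_, X]]add0r [X in `[X, _]]e1 Rintegral_shift//; last first.
    by rewrite -e1 add0r; apply: cus => //; exact: ltW.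
  have uE x : x \in `[- (pi / b), 0] ->
      u (x + l) * sin (n%:R * (x + l)) = s / b * (sin (b * x) * sin (n%:R * x)).
    move=> xI; have xI' : pi / b + x \in `[0, pi / b].
      by move: xI; rewrite !in_itv/= => /andP[x0 xb]; apply/andP; split; lra.
    have := zb _ xI'; rewrite mul0r add0r.
    have -> : pi / a + (pi / b + x) = x + l by rewrite /l; ring.
    move=> ->; have -> : b * (pi / b + x) = b * x + pi by field; rewrite gt_eqF.
    by rewrite sinDpi mulrDr nl -[2 * pi]mul1r (sinD2pin _ 1); ring.
  under eq_Rintegral => x.
    rewrite inE/= => xI; rewrite uE//; over.
  rewrite RintegralZl//; last exact: continuous_integrable.
  congr (_ * _); rewrite /Rintegral -[X in `[_, X]]oppr0 integration_by_substitution_oppr ?(ltW lb)//.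
  congr fine; apply: eq_integral => x _ /=.
  by rewrite !mulrN !sinN mulrNN.
rewrite gt_eqF// mulr_gt0 ?divr_gt0 ?pi_gt0// mulr_gt0 ?ltr0n//.
by rewrite addr_gt0// mulr_gt0 ?divr_gt0// Rintegral_sin_sin_gt0.
Qed.

End Coefficients.

(** * Square summability and passage to the Riesz basis *)

Section RieszBasis.
Context {R : realType}.
Local Notation mu := (@lebesgue_measure R).
Local Notation I := (`]0, pi[%classic : set R).

(** A telescoping form of the integral test. It rests on [exp t >= 1 + t] and on
    [ln ((x + 1) / x) >= 1 / (x + 1)]. *)
Lemma powR_telescope (eps x : R) : 0 < eps -> 0 < x ->
  eps * (x + 1) `^ (- (1 + eps)) <= x `^ (- eps) - (x + 1) `^ (- eps).
Proof.
move=> e0 x0; have x1 : 0 < x + 1 by rewrite addr_gt0.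
rewrite /powR !gt_eqF// opprD mulrDl mulN1r expRD expRN lnK//.
set y := expR (- eps * ln (x + 1)).
have -> : expR (- eps * ln x) = y * expR (eps * (ln (x + 1) - ln x)).
  by rewrite /y -expRD; congr expR; ring.
have y0 : 0 < y by exact: expR_gt0.
have -> : eps * ((x + 1)^-1 * y) = y * (eps * (x + 1)^-1) by ring.
rewrite -[X in _ - X]mulr1 -mulrBr ler_pM2l//.
have h1 : eps * (ln (x + 1) - ln x) <= expR (eps * (ln (x + 1) - ln x)) - 1.
  by rewrite lerBrDl; exact: expR_ge1Dx.
apply: le_trans h1; rewrite ler_wpM2l ?(ltW e0)//.
rewrite -[_ - _]opprB lerNr -ln_div ?posrE//.
have -> : x / (x + 1) = 1 + - (x + 1)^-1 by field; rewrite gt_eqF.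
apply: le_ln1Dx; rewrite ltrN2 invf_lt1//; lra.
Qed.

Lemma sum_powR_le (eps : R) (N : nat) : 0 < eps ->
  \sum_(1 <= n < N.+1) (n%:R : R) `^ (- (1 + eps)) <= 1 + eps^-1.
Proof.
move=> e0; case: N => [|N]; first by rewrite big_geq// addr_ge0// invr_ge0 ltW.
(* The induction requires the sharper bound that keeps the remaining tail [N.+1 ^ (- eps)]. *)
apply: (@le_trans _ _ (1 + eps^-1 * (1 - N.+1%:R `^ (- eps)))); last first.
  rewrite lerD2l ler_piMr ?invr_ge0 ?(ltW e0)//.
elim: N => [|N IH]; first by rewrite big_nat1 !powR1 subrr mulr0 addr0.
rewrite big_nat_recr//=; have := @powR_telescope eps N.+1%:R e0 (ltr0Sn _ _).
rewrite natr1 mulrC -ler_pdivlMr// => h.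
apply: le_trans (lerD IH h) _; rewrite le_eqVlt; apply/orP; left; apply/eqP; ring.
Qed.

Lemma sqr_le_Rintegral (f : R -> R) (K : R) : inL2 f ->
  (forall x, x \in I -> `|f x| <= K) -> \int[mu]_(x in I) (f x ^+ 2) <= K ^+ 2 * pi.
Proof.
move=> f2 fK; have [mf fi] := (inL2P f).1 f2.
have mI : measurable I by exact: measurable_itv.
have pi0 := pi_gt0 R.
have muI : mu I = pi%:E.
  by rewrite [LHS]lebesgue_measure_itv/= lte_fin pi0 sube0.
have -> : K ^+ 2 * pi = \int[mu]_(x in I) (K ^+ 2).
  by rewrite Rintegral_cst//; congr (_ * _); rewrite -[LHS]/(fine pi%:E) -muI.
apply: le_Rintegral => //.
  have /inL2P[] // : inL2 (fun=> K : R).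
  by apply: continuous_inL2; apply: continuous_subspaceT => x; exact: cvg_cst.
move=> x Ix; have xI : x \in I by rewrite inE.
rewrite -(real_normK (num_real (f x))) lerXn2r ?nnegrE ?fK//.
by apply: le_trans (fK x xI).
Qed.

(** Transfers the abstract perturbation results from [V] to functions; the factor [pi / 2] converts
    [ipV] into the squared [L2norm]. *)
Lemma triangular_riesz_basis (F : nat -> R -> R) (B : R) :
  (forall n, (0 < n)%N -> inL2 (F n)) ->
  (forall n x, odd n -> x \in I -> F n x = sine n x) ->
  (forall m n, (0 < m)%N -> (0 < n)%N -> ~~ odd m -> ~~ odd n -> ~~ (n %| m)%N ->
     ipL2 (F n) (sine m) = 0) ->
  (forall n, (0 < n)%N -> ~~ odd n -> ipL2 (F n) (sine n) != 0) ->
  (forall N, \sum_(1 <= n < N.+1 | ~~ odd n)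
     (2 / pi * \int[mu]_(x in I) (F n x - sine n x) ^+ 2) <= B) ->
  riesz_basis F.
Proof.
move=> F2 Fodd Ftri Fdiag Fnear.
have pi0 := pi_gt0 R.
pose G n := toL2 (F n).
have G_odd n : odd n -> G n = sineV n.
  by move=> on; apply: toL2_eq; [apply: F2; exact: odd_gt0|move=> x; exact: Fodd].
have ipG m n : (0 < n)%N -> ipV (G n) (sineV m) = ipL2 (F n) (sine m).
  by move=> n0; apply: eq_ipL2 => x xI; apply: toL2_in => //; [exact: F2|exact: sine_inL2].
have G_tri m n : (0 < m)%N -> (0 < n)%N -> ~~ odd m -> ~~ odd n -> ~~ (n %| m)%N ->
    ipV (G n) (sineV m) = 0.
  by move=> m0 n0 om on nm; rewrite ipG//; exact: Ftri.
have G_diag n : (0 < n)%N -> ~~ odd n -> ipV (G n) (sineV n) != 0.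
  by move=> n0 on; rewrite ipG//; exact: Fdiag.
have G_near N : \sum_(1 <= n < N.+1 | ~~ odd n)
    ipV (G n - sineV n) (G n - sineV n) <= B.
  apply: le_trans (Fnear N); rewrite le_eqVlt; apply/orP; left; apply/eqP.
  rewrite big_nat_cond [RHS]big_nat_cond; apply: eq_bigr => n /andP[/andP[n0 _] _].
  by apply: ipV_toL2B; [exact: F2|exact: sine_inL2].
have B0 : 0 <= B by apply: le_trans (G_near 0%N); rewrite big_geq.
have hC := @ipL2C R; have hD := @ipL2Dl R; have hZ := @ipL2Zl R; have hp := @ipL2_ge0 R.
have complete := perturbed_complete (ip := ipV) hC hD hZ hp (@ipV_sine R) (@sineV_complete R)
  G_odd G_tri G_diag G_near.
have [c c0 lower] := perturbed_lower (ip := ipV) hC hD hZ hp (@ipV_sine R) G_odd G_tri G_diag G_near.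
have upper := perturbed_upper (ip := ipV) hC hD hZ hp (@ipV_sine R) G_odd G_near.
have lincombE N (a : nat -> R) : L2norm (lincomb F N a) ^+ 2 =
    pi / 2 * ipV (\sum_(1 <= n < N.+1) a n *: G n) (\sum_(1 <= n < N.+1) a n *: G n).
  rewrite L2norm_ipL2; congr (_ * _); apply: eq_ipL2 => x xI;
    by rewrite toL2_lincomb.
split => //.
  move=> g g2 e e0; have d0 : 0 < 2 / pi * e ^+ 2 by rewrite mulr_gt0 ?divr_gt0 ?exprn_gt0.
  have [s [N [a sE]] sd] := complete (toL2 g) _ d0.
  exists N, a; rewrite ltNge; apply/negP => eL.
  have : e ^+ 2 <= L2norm (g \- lincomb F N a) ^+ 2 by rewrite lerXn2r// nnegrE ltW// (lt_le_trans e0).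
  rewrite L2norm_ipL2 leNgt => /negP; apply.
  rewrite -ltr_pdivlMl ?divr_gt0// invf_div.
  apply: le_lt_trans sd; rewrite le_eqVlt; apply/orP; left; apply/eqP.
  change (ipL2 (g \- lincomb F N a) (g \- lincomb F N a) = ipL2 (toL2 g - s : _) (toL2 g - s)).
  apply: eq_ipL2 => x xI; rewrite sE.
    by rewrite -[RHS]/(toL2 g x - (\sum_(1 <= n < N.+1) a n *: G n) x) toL2_lincomb// toL2_in.
  by rewrite -[RHS]/(toL2 g x - (\sum_(1 <= n < N.+1) a n *: G n) x) toL2_lincomb// toL2_in.
exists (pi / 2 * c), (pi / 2 * (2 + 2 * B)); split.
- by rewrite mulr_gt0// divr_gt0.
- by rewrite mulr_gt0 ?divr_gt0//; lra.
move=> N a; rewrite lincombE.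
have -> : \sum_(1 <= n < N.+1) `|a n| ^+ 2 = \sum_(1 <= n < N.+1) a n ^+ 2.
  by apply: eq_bigr => n _; exact: real_normK (num_real _).
by rewrite -!mulrA !ler_pM2l ?divr_gt0// lower upper.
Qed.

End RieszBasis.

Theorem corollary1p8 (R : realType) (alpha beta : nat -> R)
    (F : nat -> R -> R) (hF : fucik_system alpha beta F)
    (hodd : forall n : nat, odd n -> alpha n = n%:R ^+ 2 /\ beta n = n%:R ^+ 2)
    (eps c : R) (heps : 0 < eps) (hc : 0 < c)
    (heven : forall n : nat, (0 < n)%N -> ~~ odd n ->
      Num.max (Num.sqrt (alpha n)) (Num.sqrt (beta n))
        <= n%:R + Num.sqrt c * n%:R `^ ((1 - eps) / 2)) :
  riesz_basis F.
Proof.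
have [_ curve eigen] := hF.
have oddF n x : odd n -> x \in `[0, pi] -> F n x = sine n x.
  move=> on; have n0 := odd_gt0 on; have [an bn] := hodd n on.
  by have := eigen n n0; rewrite an bn => /(odd_profile n0); apply.
have prof n : (0 < n)%N -> ~~ odd n ->
    even_profile (Num.sqrt (alpha n)) (Num.sqrt (beta n)) n./2 (F n).
  move=> n0 on; apply: even_profileP => //; last exact: eigen.
  by apply: curve; move: n0 on; case: n => [|[|?]].
have IcI x : x \in (`]0, pi[%classic : set R) -> x \in `[0, pi].
  by rewrite inE/= !in_itv/= => /andP[x0 xpi]; rewrite !ltW.
have F2 n : (0 < n)%N -> inL2 (F n).
  move=> n0; have [on|on] := boolP (odd n).
    apply: (inL2_eq (f := sine n)); last exact: sine_inL2.
    by move=> x /IcI xI; rewrite oddF.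
  by apply: continuous_inL2; case: (prof n n0 on).
(* In [2 / pi * (k ^+ 2 * pi)] the length of the interval cancels, leaving 2 times
   [(2 + pi)^2 c n^(- (1 + eps))]. *)
pose K := 2 * ((2 + pi) ^+ 2 * c) : R.
have K0 : 0 <= K by rewrite mulr_ge0// mulr_ge0 ?sqr_ge0// ltW.
apply: (@triangular_riesz_basis R F (K * (1 + eps^-1))) => //.
- by move=> n x on /IcI; exact: oddF.
- by move=> m n m0 n0 om on nm; exact: even_profile_orth (prof n n0 on) _ m0 om nm.
- by move=> n n0 on; exact: even_profile_diag (prof n n0 on).
move=> N; apply: le_trans (ler_wpM2l K0 (sum_powR_le N heps)).
rewrite mulr_sumr [leRHS](bigID (fun n => ~~ odd n))/= -[leLHS]addr0.
apply: lerD; last by apply: sumr_ge0 => n _; rewrite mulr_ge0// powR_ge0.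
rewrite big_nat_cond [leRHS]big_nat_cond; apply: ler_sum => n /andP[/andP[n0 _] on].
have N0 : 0 < n%:R :> R by rewrite ltr0n.
pose k := (2 + pi) * (Num.sqrt c * n%:R `^ ((1 - eps) / 2) / n%:R).
have near x : x \in (`]0, pi[%classic : set R) -> `|(F n \- sine n) x| <= k.
  move=> /IcI xI; apply: le_trans (even_profile_near n0 on (prof n n0 on) xI) _.
  have pi2 : 0 <= 2 + pi :> R by exact: addr_ge0 (ler0n _ 2) (pi_ge0 R).
  rewrite /k (ler_wpM2l pi2)// ler_wpM2r ?invr_ge0 ?(ltW N0)//.
  by rewrite lerBlDl; exact: heven.
have := sqr_le_Rintegral (inL2B (F2 n n0) (sine_inL2 n)) near.
(* Squaring doubles the exponent [(1 - eps) / 2], and the division by [n ^+ 2] lowers it to the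
   summable [- (1 + eps)]. *)
have kE : k ^+ 2 = (2 + pi) ^+ 2 * c * n%:R `^ (- (1 + eps)).
  have -> : k ^+ 2 = (2 + pi) ^+ 2 * Num.sqrt c ^+ 2 *
      ((n%:R `^ ((1 - eps) / 2)) ^+ 2 / n%:R ^+ 2) by rewrite /k; field; rewrite gt_eqF.
  rewrite (sqr_sqrtr (ltW hc)); congr (_ * _).
  rewrite -powR_mulrn ?powR_ge0// -powRrM -powR_mulrn ?(ltW N0)// -powRN -powRD.
    by congr (_ `^ _); field.
  by apply/implyP => _; rewrite gt_eqF.
rewrite kE => h; apply: le_trans (ler_wpM2l _ h) _; first by rewrite divr_ge0 ?pi_ge0.
rewrite le_eqVlt; apply/orP; left; apply/eqP; rewrite /K.
by move: (pi_gt0 R); move: (pi : R) => q q0; field; rewrite gt_eqF.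
Qed.
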